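(* Let $n\in\mathbb{N}$, let $R_n=\mathbb{Q}[r_j,g_j][[s_j,W_{ij},f_j\mid 1\le i,j\le n]]$, and let $P=P(r,s)\in R_n$ depend only on $r=(r_1,\dots,r_n)$ and $s=(s_1,\dots,s_n)$, such that the contractions below are well defined. With $\tilde W=(1-W)^{-1}$, $$\big\langle P(r,s)\,e^{gs+rf+rWs}\big\rangle_{r,s}=\det(\tilde W)\,e^{g\tilde Wf}\,\big\langle P\big(r+g\tilde W,\ \tilde W(s+f)\big)\big\rangle_{r,s}.$$
   Context: Here $r=(r_i)$, $s=(s_i)$, $g=(g_i)$, $f=(f_i)$ are vectors of $n$ formal variables and $W=(W_{ij})$ is an $n\times n$ matrix of formal variables; $gs=\sum_i g_is_i$, $rf=\sum_i r_if_i$, $rWs=\sum_{i,j}r_iW_{ij}s_j$, and $g\tilde W f=\sum_{i,j}g_i\tilde W_{ij}f_j$. In arguments of $P$, $g\tilde W$ is the vector with components $\sum_i g_i\tilde W_{ij}$ and $\tilde W(s+f)$ is the vector with components $\sum_j\tilde W_{ij}(s_j+f_j)$. $(1-W)^{-1}=\sum_{k\ge 0}W^k$ as a power series. **Contraction.** For a series $h(r,s)=\sum_{k,\ell\in\mathbb{N}^n}c_{k,\ell}\,r^ks^\ell$ (multi-index notation, with coefficients $c_{k,\ell}$ in the remaining variables), its contraction along the pairs $(r_i,s_i)$ is $\langle h\rangle_{r,s}=\sum_{k\in\mathbb{N}^n}k!\,c_{k,k}$, with $k!=\prod_ik_i!$. It is well defined when, for each monomial in the remaining variables, only finitely many terms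 contribute to its coefficient (for example $\langle e^{r_1s_1}\rangle$ is not defined); the result is a formal power series in the remaining variables. *)

(* Defs.v *)
From HB Require Import structures.
From mathcomp Require Import all_boot all_order all_algebra.
From mathcomp Require Import all_classical.

Set Implicit Arguments.
Unset Strict Implicit.
Unset Printing Implicit Defensive.

Import GRing.Theory.
Local Open Scope ring_scope.
Local Open Scope classical_set_scope.

Notation monom I := {ffun I -> nat}.

Section Monomials.
Variable I : finType.
Implicit Types (m k j : monom I).

Definition mone : monom I := [ffun => 0%N].
Definition madd m k : monom I := [ffun i => (m i + k i)%N].
Definition msub m k : monom I := [ffun i => (m i - k i)%N].
Definition mle m k := [forall i, (m i <= k i)%N].

(* The divisors of the monomial [m], each listed once. *)
Definition mdivisors m : seq (monom I) :=
  [seq [ffun i => (x i : nat)] | x : {dffun forall i : I, 'I_(m i).+1}].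

Lemma mem_mdivisors m k : (k \in mdivisors m) = mle k m.
Proof.
apply/fintype.imageP/forallP => [[x _ ->] i|le_km]; first by rewrite ffunE -ltnS.
exists [ffun i => inord (k i) : 'I_(m i).+1] => //.
by apply/ffunP => i; rewrite !ffunE inordK // ltnS.
Qed.

Lemma mdivisors_uniq m : uniq (mdivisors m).
Proof.
rewrite map_inj_uniq ?enum_uniq // => x y /ffunP eq_xy.
by apply/ffunP => i; apply/val_inj; have := eq_xy i; rewrite !ffunE.
Qed.

End Monomials.

Record fps (R : Type) (I : finType) := Fps { coef : monom I -> R }.

HB.instance Definition _ (R : Type) (I : finType) := [isNew for @coef R I].
HB.instance Definition _ (R : choiceType) (I : finType) :=
  [Choice of fps R I by <:].

Section Ring.
Variables (R : comNzRingType) (I : finType).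
Implicit Types (f g h : fps R I) (m : monom I).

Lemma fpsP f g : coef f =1 coef g <-> f = g.
Proof. by split=> [/funext eq_fg|->//]; apply/val_inj. Qed.

Definition fps_zero : fps R I := Fps (fun=> 0).
Definition fps_opp f : fps R I := Fps (fun m => - coef f m).
Definition fps_add f g : fps R I := Fps (fun m => coef f m + coef g m).
Definition fps_one : fps R I := Fps (fun m => (m == mone I)%:R).
Definition fps_mul f g : fps R I :=
  Fps (fun m => \sum_(k <- mdivisors m) coef f k * coef g (msub m k)).
Definition fps_scale (c : R) f : fps R I := Fps (fun m => c * coef f m).

Fact fps_addA : associative fps_add.
Proof. by move=> f g h; apply/fpsP => m /=; rewrite addrA. Qed.
Fact fps_addC : commutative fps_add.
Proof. by move=> f g; apply/fpsP => m /=; rewrite addrC. Qed.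
Fact fps_add0 : left_id fps_zero fps_add.
Proof. by move=> f; apply/fpsP => m /=; rewrite add0r. Qed.
Fact fps_addN : left_inverse fps_zero fps_opp fps_add.
Proof. by move=> f; apply/fpsP => m /=; rewrite addNr. Qed.

HB.instance Definition _ :=
  GRing.isZmodule.Build (fps R I) fps_addA fps_addC fps_add0 fps_addN.

Fact fps_mulC : commutative fps_mul.
Proof.
move=> f g; apply/fpsP => m /=.
have subK k : k \in mdivisors m -> msub m (msub m k) = k.
  rewrite mem_mdivisors => /forallP le_km.
  by apply/ffunP => i; rewrite !ffunE subKn.
have perm_sub : perm_eq (mdivisors m) [seq msub m k | k <- mdivisors m].
  apply: uniq_perm; first exact: mdivisors_uniq.
    rewrite map_inj_in_uniq ?mdivisors_uniq // => k1 k2 /subK {2}<- /subK {2}<-.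
    by move=> ->.
  move=> k; apply/idP/mapP => [k_m|[j _ ->]].
    exists (msub m k); last by rewrite subK.
    by rewrite mem_mdivisors; apply/forallP => i; rewrite ffunE leq_subr.
  by rewrite mem_mdivisors; apply/forallP => i; rewrite ffunE leq_subr.
rewrite (perm_big _ perm_sub) big_map big_seq [RHS]big_seq.
by apply: eq_bigr => k k_m; rewrite subK // mulrC.
Qed.

Fact fps_mulA : associative fps_mul.
Proof.
move=> f g h; apply/fpsP => m /=.
under eq_bigr do rewrite big_distrr.
under [RHS]eq_bigr do rewrite big_distrl.
rewrite /= -(big_allpairs_dep (I2 := fun=> monom I)
  (h := fun k j : monom I => (k, j))
  (F := fun p => coef f p.1 * (coef g p.2 * coef h (msub (msub m p.1) p.2)))).
rewrite -(big_allpairs_dep (I2 := fun=> monom I)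
  (h := fun k j : monom I => (k, j))
  (F := fun p => coef f p.2 * coef g (msub p.1 p.2) * coef h (msub m p.1))).
set s := (S in \sum_(p <- S) _ = _); set t := (S in _ = \sum_(p <- S) _).
have mem_s p : p \in s = mle p.1 m && mle p.2 (msub m p.1).
  apply/allpairsPdep/andP => [[k [j [+ + ->]]]|[]].
    by rewrite !mem_mdivisors.
  by rewrite -!mem_mdivisors; case: p => k j; exists k, j.
have mem_t p : p \in t = mle p.1 m && mle p.2 p.1.
  apply/allpairsPdep/andP => [[k [j [+ + ->]]]|[]].
    by rewrite !mem_mdivisors.
  by rewrite -!mem_mdivisors; case: p => k j; exists k, j.
have s_uniq : uniq s.
  by apply: allpairs_uniq_dep => [|k _|[? ?] [? ?] _ _ [-> ->]//];
    exact: mdivisors_uniq.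
have t_uniq : uniq t.
  by apply: allpairs_uniq_dep => [|k _|[? ?] [? ?] _ _ [-> ->]//];
    exact: mdivisors_uniq.
have perm_st : perm_eq s [seq (p.2, msub p.1 p.2) | p <- t].
  apply: uniq_perm => //.
    rewrite map_inj_in_uniq // => -[k1 j1] [k2 j2]; rewrite !mem_t /=.
    move=> /andP[_ /forallP le1] /andP[_ /forallP le2] [eq_j /ffunP eq_k].
    rewrite -eq_j in le2 eq_k *; congr pair; apply/ffunP => i; have := eq_k i; rewrite !ffunE => eq_ki.
    by rewrite -(subnK (le1 i)) eq_ki subnK ?le2.
  move=> [j i]; rewrite mem_s /=.
  apply/andP/mapP => [[/forallP le_jm /forallP le_ijm]|[[k j'] + [-> ->]]].
    exists (madd j i, j); rewrite ?mem_t /=.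
      apply/andP; split; apply/forallP => x; rewrite !ffunE ?leq_addr //.
      by have := le_ijm x; rewrite ffunE leq_subRL.
    by congr pair; apply/ffunP => x; rewrite !ffunE addKn.
  rewrite mem_t /= => /andP[/forallP le_km /forallP le_jk].
  split; apply/forallP => x; first exact: leq_trans (le_jk x) (le_km x).
  by rewrite !ffunE leq_sub2r.
rewrite (perm_big _ perm_st) big_map /= big_seq [RHS]big_seq.
apply: eq_bigr => -[k j]; rewrite mem_t /= => /andP[_ /forallP le_jk].
rewrite mulrA; congr (_ * coef h _).
by apply/ffunP => i; rewrite !ffunE -subnDA subnKC.
Qed.

Fact fps_mul1 : left_id fps_one fps_mul.
Proof.
move=> f; apply/fpsP => m /=.
have m1 : mone I \in mdivisors m.
  by rewrite mem_mdivisors; apply/forallP => i; rewrite ffunE.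
rewrite (bigD1_seq _ m1) ?mdivisors_uniq //= eqxx mul1r big1 => [|k /negPf->].
  by rewrite addr0; congr (coef f _); apply/ffunP => i; rewrite !ffunE subn0.
by rewrite mul0r.
Qed.

Fact fps_mulDl : left_distributive fps_mul fps_add.
Proof.
move=> f g h; apply/fpsP => m /=; rewrite -big_split.
by apply: eq_bigr => k _; rewrite mulrDl.
Qed.

Fact fps_one_neq0 : fps_one != 0.
Proof.
apply/eqP => /fpsP /(_ (mone I)) /=; rewrite eqxx.
exact/eqP/oner_neq0.
Qed.

HB.instance Definition _ := GRing.Zmodule_isComNzRing.Build (fps R I)
  fps_mulA fps_mulC fps_mul1 fps_mulDl fps_one_neq0.

Fact fps_scaleA (a b : R) f : fps_scale a (fps_scale b f) = fps_scale (a * b) f.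
Proof. by apply/fpsP => m /=; rewrite mulrA. Qed.
Fact fps_scale1 : left_id 1 fps_scale.
Proof. by move=> f; apply/fpsP => m /=; rewrite mul1r. Qed.
Fact fps_scaleDr : right_distributive fps_scale +%R.
Proof. by move=> a f g; apply/fpsP => m /=; rewrite mulrDr. Qed.
Fact fps_scaleDl f : {morph fps_scale^~ f : a b / a + b}.
Proof. by move=> a b; apply/fpsP => m /=; rewrite mulrDl. Qed.

HB.instance Definition _ := GRing.Zmodule_isLmodule.Build R (fps R I)
  fps_scaleA fps_scale1 fps_scaleDr fps_scaleDl.

Definition fps_var (i : I) : fps R I :=
  Fps (fun m => (m == [ffun j => (j == i : nat)])%:R).

(* A family of series is summable when every monomial gets a nonzero
   coefficient in only finitely many members; the sum is then taken
   coefficientwise.  The finitely supported sum over [setT] is 0 at a monomial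
   violating this, so [fps_sum] is meaningful on summable families only. *)
Definition fps_summable (J : choiceType) (F : J -> fps R I) : Prop :=
  forall m, finite_set [set j | coef (F j) m != 0].

Definition fps_sum (J : choiceType) (F : J -> fps R I) : fps R I :=
  Fps (fun m => \sum_(j \in [set: J]) coef (F j) m).

(* [h] with [u v] substituted for each variable [v].  The family is summable
   when every [u v] has zero constant term. *)
Definition fps_comp (h : fps R I) (u : I -> fps R I) : fps R I :=
  fps_sum (fun k : monom I => coef h k *: \prod_i u i ^+ k i).

Definition depends_only_on (A : pred I) (h : fps R I) : Prop :=
  forall m, coef h m != 0 -> forall i, ~~ A i -> m i = 0%N.

(* [h] is a power series in the variables outside [A], with coefficients that
   are polynomials in the variables in [A]. *)
Definition polynomial_in (A : pred I) (h : fps R I) : Prop :=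
  forall m, finite_set
    [set k : monom I | coef h k != 0 /\ forall i, ~~ A i -> k i = m i].

End Ring.

Arguments fps_var {R I} i.

(* The family is summable when [h] has zero constant term. *)
Definition fps_exp (I : finType) (h : fps rat I) : fps rat I :=
  fps_sum (fun k : nat => (k`!%:R)^-1 *: h ^+ k).

Inductive var (n : nat) : Type :=
  | Vr of 'I_n | Vs of 'I_n | Vg of 'I_n | Vf of 'I_n | VW of 'I_n & 'I_n.
Arguments Vr {n} i.
Arguments Vs {n} i.
Arguments Vg {n} i.
Arguments Vf {n} i.
Arguments VW {n} i j.

Section VarFinType.
Variable n : nat.

Definition var_code (v : var n) : 'I_n + 'I_n + ('I_n + 'I_n) + 'I_n * 'I_n :=
  match v with
  | Vr i => inl (inl (inl i)) | Vs i => inl (inl (inr i))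
  | Vg i => inl (inr (inl i)) | Vf i => inl (inr (inr i))
  | VW i j => inr (i, j)
  end.
Definition var_decode (x : 'I_n + 'I_n + ('I_n + 'I_n) + 'I_n * 'I_n) : var n :=
  match x with
  | inl (inl (inl i)) => Vr i | inl (inl (inr i)) => Vs i
  | inl (inr (inl i)) => Vg i | inl (inr (inr i)) => Vf i
  | inr (i, j) => VW i j
  end.
Fact var_codeK : cancel var_code var_decode.
Proof. by case. Qed.

HB.instance Definition _ := Finite.copy (var n) (can_type var_codeK).

End VarFinType.

Definition is_r_or_g n (v : var n) : bool :=
  match v with Vr _ | Vg _ => true | _ => false end.
Definition is_r_or_s n (v : var n) : bool :=
  match v with Vr _ | Vs _ => true | _ => false end.

(* The full ring Q[[r, s, g, f, W]].  All the constructions take place in it;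
   Q[r, g][[s, W, f]] is the subring singled out by [in_Rn]. *)
Notation Qseries n := (fps rat (var n)).

Section Contraction.
Variable n : nat.

Implicit Types (h P : Qseries n) (k l : monom 'I_n).

Definition in_Rn h : Prop := polynomial_in (@is_r_or_g n) h.

Definition rs_monom k l : monom (var n) :=
  [ffun v => match v with Vr i => k i | Vs i => l i | _ => 0%N end].

(* The coefficient c_{k,l} of r^k s^l in [h], a series in the remaining
   variables, i.e. without any monomial involving r or s. *)
Definition rs_coef k l h : Qseries n :=
  Fps (fun m => if [forall v, is_r_or_s v ==> (m v == 0%N)]
                then coef h (madd m (rs_monom k l)) else 0).

Definition contraction_terms h k : Qseries n :=
  (\prod_i (k i)`!)%:R *: rs_coef k k h.

Definition contractible h : Prop := fps_summable (contraction_terms h).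

Definition contraction h : Qseries n := fps_sum (contraction_terms h).

Definition r_ (i : 'I_n) : Qseries n := fps_var (Vr i).
Definition s_ (i : 'I_n) : Qseries n := fps_var (Vs i).
Definition g_ (i : 'I_n) : Qseries n := fps_var (Vg i).
Definition f_ (i : 'I_n) : Qseries n := fps_var (Vf i).
Definition W_ : 'M[Qseries n]_n := \matrix_(i, j) fps_var (VW i j).

(* (1 - W)^-1 = \sum_k W^k, entrywise. *)
Definition Wt : 'M[Qseries n]_n :=
  \matrix_(i, j) fps_sum (fun k : nat => (W_ ^+ k) i j).

(* P(u, v), for [P] involving no variables other than r and s. *)
Definition subst_rs P (u v : 'I_n -> Qseries n) : Qseries n :=
  fps_comp P (fun x => match x with
                       | Vr i => u i
                       | Vs i => v i
                       | _ => fps_var x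
                       end).

End Contraction.

Arguments r_ {n} i.
Arguments s_ {n} i.
Arguments g_ {n} i.
Arguments f_ {n} i.
Arguments W_ {n}.
Arguments Wt {n}.

(* Main.v *)
Require Import Defs.
From HB Require Import structures.
From mathcomp Require Import all_boot all_order all_algebra.
From mathcomp Require Import perm all_classical.
From mathcomp Require Import zify ring.
Import Order.TTheory GRing.Theory Num.Theory.
Local Open Scope ring_scope.

(** Write [<h>] for the contraction of [h], [E] for the Gaussian
[exp (gs + rf + rWs)] and [G] for [(1 - W)^-1].

Contraction exchanges multiplication by [s_i] with the derivative in [r_i], and
multiplication by [r_i] with the derivative in [s_i] ([contraction_var]).  When
the derivative in [r_i] falls on the factor [E] of [h * E] it multiplies it by
[f_i + \sum_j W_ij s_j], so that the unknowns [<s_i h E>] satisfy a linear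
system with matrix [1 - W], and
[<s_i h E> = \sum_j G_ij <(dh/dr_j + f_j h) E>];
likewise for [r_i] with [G] transposed ([gauss_by_parts_s],
[gauss_by_parts_r]).  The contraction of the substituted monomial
[(r + gG)^a (G(s + f))^b] obeys the same recursion in [a] and [b], because the
derivative in [r_j] does not see the shifts.  Induction on the degree gives the
theorem for monomials, up to the factor [<E>] ([gauss_moment]).

To compute [<E>], integrate by parts once more: each derivative of [<E>] in a
variable [v] among [g], [f], [W] is [c_v <E>] for an explicit [c_v], and
Jacobi's formula for [det G] shows that [det G * exp (gGf)] satisfies the same
equations.  A series over a domain of characteristic 0 is determined by such a
system and its constant term ([partial_system_unique], [contraction_gauss]).

For a general series [P] give [r_i], [s_i], [g_i], [f_i], [W_ij] the weights
[e_i], [- e_i], [e_i], [- e_i], [e_j - e_i] in Z^n.  Then [E] has weight 0, and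
both contraction and the substitution preserve weights, so the coefficient of a
monomial [m] on either side involves only the component of [P] of the weight of
[m].  If [P * E] can be contracted, this component is a polynomial: given [m]
free of [r] and [s] there is exactly one monomial [t] in [r], [s] such that [mt]
occurs in [E] ([gauss_support], [gauss_support_unique]), so the monomials
of the component contribute to different terms of the contraction and cannot
cancel ([finite_component]).  Linearity then extends the formula from monomials
to [P] ([gaussian_contraction]).

The rules used for [<h>] require that the sums be finite.  All series [h] that
occur after the reduction to monomials are [tame]: their degree in [r], [s] is
at most twice their degree in the other variables, up to a constant. *)

Set Implicit Arguments.
Unset Strict Implicit.
Unset Printing Implicit Defensive.

(** * Monomials and coefficients *)

Section MonomialTheory.
Variable I : finType.
Implicit Types (m k j : monom I) (v : I).

Definition mvar v : monom I := [ffun j => (j == v : nat)].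
Definition mdeg m : nat := (\sum_i m i)%N.

Lemma mleP m k : reflect (forall i, m i <= k i)%N (mle m k).
Proof. exact: forallP. Qed.

Lemma maddE m k i : madd m k i = (m i + k i)%N.
Proof. by rewrite ffunE. Qed.

Lemma msubE m k i : msub m k i = (m i - k i)%N.
Proof. by rewrite ffunE. Qed.

Lemma mvarE v i : mvar v i = (i == v) :> nat.
Proof. by rewrite ffunE. Qed.

Lemma moneE i : mone I i = 0%N.
Proof. by rewrite ffunE. Qed.

Definition monomE := (maddE, msubE, mvarE, moneE).

Lemma maddC m k : madd m k = madd k m.
Proof. by apply/ffunP => i; rewrite !monomE addnC. Qed.

Lemma maddA m k j : madd m (madd k j) = madd (madd m k) j.
Proof. by apply/ffunP => i; rewrite !monomE addnA. Qed.

Lemma maddAC m k j : madd (madd m k) j = madd (madd m j) k.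
Proof. by rewrite -!maddA (maddC k). Qed.

Lemma madd0m m : madd (mone I) m = m.
Proof. by apply/ffunP => i; rewrite !monomE. Qed.

Lemma maddm0 m : madd m (mone I) = m.
Proof. by rewrite maddC madd0m. Qed.

Lemma maddK m k : msub (madd m k) k = m.
Proof. by apply/ffunP => i; rewrite !monomE addnK. Qed.

Lemma maddKl m k : msub (madd m k) m = k.
Proof. by rewrite maddC maddK. Qed.

Lemma maddIr m k j : madd m j = madd k j -> m = k.
Proof. by move=> eq_mk; rewrite -(maddK m j) eq_mk maddK. Qed.

Lemma msubK m k : mle k m -> madd (msub m k) k = m.
Proof. by move=> /mleP le_km; apply/ffunP => i; rewrite !monomE subnK. Qed.

Lemma mle_addl m k : mle k (madd m k).
Proof. by apply/mleP => i; rewrite !monomE leq_addl. Qed.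

Lemma mle_var v m : mle (mvar v) m = (0 < m v)%N.
Proof.
apply/mleP/idP => [/(_ v)|m_v i]; rewrite mvarE ?eqxx //.
by case: eqP => // ->.
Qed.

Lemma mdeg0 : mdeg (mone I) = 0%N.
Proof. by rewrite /mdeg big1 // => i _; rewrite moneE. Qed.

Lemma mdegD m k : mdeg (madd m k) = (mdeg m + mdeg k)%N.
Proof. by rewrite -big_split; apply: eq_bigr => i _; rewrite maddE. Qed.

Lemma mdeg_var v : mdeg (mvar v) = 1%N.
Proof.
rewrite /mdeg (bigD1 v) //= big1 ?mvarE ?eqxx // => i /negPf neq_iv.
by rewrite mvarE neq_iv.
Qed.

Lemma leq_mdeg m i : (m i <= mdeg m)%N.
Proof. by rewrite /mdeg (bigD1 i) //= leq_addr. Qed.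

Lemma mdeg_eq0 m : mdeg m = 0%N -> m = mone I.
Proof.
move=> m0; apply/ffunP => i; have := leq_mdeg m i.
by rewrite m0 moneE; case: (m i).
Qed.

Lemma mdegB m k : mle k m -> mdeg m = (mdeg (msub m k) + mdeg k)%N.
Proof. by move=> /msubK {1}<-; rewrite mdegD. Qed.

Lemma monom_ind (P : monom I -> Prop) :
    P (mone I) -> (forall m v, P m -> P (madd m (mvar v))) -> forall m, P m.
Proof.
move=> P0 PS m; move: {2}(mdeg m) (erefl (mdeg m)) => d.
elim: d m => [|d IHd] m deg_m; first by rewrite (mdeg_eq0 deg_m).
have [v m_v] : exists v, (0 < m v)%N.
  apply/existsP; apply: contra_eqT deg_m => /existsPn m0.
  by rewrite /mdeg big1 // => i _; have := m0 i; case: (m i).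
rewrite -(@msubK m (mvar v)) ?mle_var //; apply: PS; apply: IHd.
by have := @mdegB m (mvar v); rewrite mle_var mdeg_var => /(_ m_v); lia.
Qed.

End MonomialTheory.

Section Coefficients.
Variables (R : comNzRingType) (I : finType).
Implicit Types (f g h : fps R I) (m k : monom I) (v : I).

Lemma coef0 m : coef (0 : fps R I) m = 0. Proof. by []. Qed.
Lemma coef1 m : coef (1 : fps R I) m = (m == mone I)%:R. Proof. by []. Qed.
Lemma coefD f g m : coef (f + g) m = coef f m + coef g m. Proof. by []. Qed.
Lemma coefN f m : coef (- f) m = - coef f m. Proof. by []. Qed.
Lemma coefB f g m : coef (f - g) m = coef f m - coef g m. Proof. by []. Qed.
Lemma coefZ c f m : coef (c *: f) m = c * coef f m. Proof. by []. Qed.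
Lemma coefM f g m :
  coef (f * g) m = \sum_(k <- mdivisors m) coef f k * coef g (msub m k).
Proof. by []. Qed.

Lemma coef_sum (J : Type) (s : seq J) (A : pred J) (F : J -> fps R I) m :
  coef (\sum_(j <- s | A j) F j) m = \sum_(j <- s | A j) coef (F j) m.
Proof. by elim/big_rec2: _ => // j x y _ <-. Qed.

Lemma fps_eqP f g : (forall m, coef f m = coef g m) -> f = g.
Proof. by move=> /fpsP. Qed.

Lemma fps_scaleAl c f g : (c *: f) * g = c *: (f * g).
Proof.
apply: fps_eqP => m; rewrite coefM coefZ coefM big_distrr /=.
by apply: eq_bigr => k _; rewrite mulrA.
Qed.

Lemma coefM_neq0 f g m : coef (f * g) m != 0 ->
  exists2 k, mle k m & coef f k != 0 /\ coef g (msub m k) != 0.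
Proof.
rewrite coefM; apply: contraNP => no_k; rewrite big_seq big1 //.
move=> k; rewrite mem_mdivisors => le_km.
have [->|fk] := eqVneq (coef f k) 0; first by rewrite mul0r.
have [->|gk] := eqVneq (coef g (msub m k)) 0; first by rewrite mulr0.
by case: no_k; exists k.
Qed.

(** Multiplication by such a series only shifts the coefficients, which products
of powers of variables do not make visible. *)
Definition fps_mono k : fps R I := Fps (fun m => (m == k)%:R).

Lemma coef_mono k m : coef (fps_mono k) m = (m == k)%:R. Proof. by []. Qed.

Lemma fps_varE v : fps_var v = fps_mono (mvar v). Proof. by []. Qed.

Lemma coef_monoM k f m :
  coef (fps_mono k * f) m = if mle k m then coef f (msub m k) else 0.
Proof.
rewrite coefM; case: ifPn => [le_km|nle_km].
  rewrite (bigD1_seq k) ?mem_mdivisors ?mdivisors_uniq //= eqxx mul1r.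
  by rewrite big1 ?addr0 // => j /negPf->; rewrite mul0r.
rewrite big_seq big1 // => j; rewrite mem_mdivisors.
by rewrite coef_mono; case: eqP => [->|_ _]; rewrite ?(negPf nle_km) // mul0r.
Qed.

Lemma coef_monoMD k f m : coef (fps_mono k * f) (madd m k) = coef f m.
Proof. by rewrite coef_monoM mle_addl maddK. Qed.

Lemma coef_varM v f m :
  coef (fps_var v * f) m = if (0 < m v)%N then coef f (msub m (mvar v)) else 0.
Proof. by rewrite fps_varE coef_monoM mle_var. Qed.

Lemma fps_monoD k j : fps_mono (madd k j) = fps_mono k * fps_mono j.
Proof.
apply: fps_eqP => m; rewrite coef_monoM !coef_mono; case: ifPn => [le_km|].
  congr (_%:R); congr (nat_of_bool _); apply/eqP/eqP => [->|<-].
    exact: maddKl.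
  by rewrite maddC msubK.
by case: eqP => // ->; rewrite maddC mle_addl.
Qed.

Lemma fps_mono0 : fps_mono (mone I) = 1. Proof. by []. Qed.

Lemma prod_fps_var k : \prod_v fps_var v ^+ k v = fps_mono k.
Proof.
elim/monom_ind: k => [|k v IHk].
  by rewrite big1 // => v _; rewrite moneE.
rewrite fps_monoD -IHk mulrC (bigD1 v) //= [in RHS](bigD1 v) //= mulrA.
rewrite !monomE eqxx addn1 exprS; congr (_ * _).
by apply: eq_bigr => u /negPf neq_uv; rewrite !monomE neq_uv addn0.
Qed.

Lemma fps_var_lreg v : GRing.lreg (fps_var v : fps R I).
Proof.
move=> f g eq_fg; apply: fps_eqP => m.
by rewrite -(coef_monoMD (mvar v)) -fps_varE eq_fg coef_monoMD.
Qed.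

Lemma coef_fps_sum (J : choiceType) (F : J -> fps R I) (s : seq J) m :
    uniq s -> (forall j, coef (F j) m != 0 -> j \in s) ->
  coef (fps_sum F) m = \sum_(j <- s) coef (F j) m.
Proof.
move=> s_uniq supp_s; rewrite /= fsbig_supp; apply: fsbig_fwiden => //.
  by move=> j [_ /eqP/supp_s].
by move=> j /= [_ /not_andP[//|/contrapT]].
Qed.

Lemma coef_fps_sum_neq0 (J : choiceType) (F : J -> fps R I) m :
  coef (fps_sum F) m != 0 -> exists j, coef (F j) m != 0.
Proof.
apply: contraNP => /forallNP F0; rewrite /= fsbig1 // => j _.
by apply/eqP; have /negP := F0 j; rewrite negbK.
Qed.

(** The only divisor of the monomial 1 is itself. *)
Lemma coef0M f g :
  coef (f * g) (mone I) = coef f (mone I) * coef g (mone I).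
Proof.
rewrite coefM (bigD1_seq (mone I)) ?mdivisors_uniq //=; last first.
  by rewrite mem_mdivisors; apply/mleP => i; rewrite moneE.
rewrite big_seq_cond big1 ?addr0; last first.
  move=> k /andP[+ /eqP k_neq0]; rewrite mem_mdivisors => /mleP k0.
  by case: k_neq0; apply/ffunP => i; have := k0 i; rewrite moneE; case: (k i).
by congr (_ * coef g _); apply/ffunP => i; rewrite !monomE.
Qed.

End Coefficients.

Arguments fps_mono {R I}.

(** * Weights and the order filtration *)

Section Support.
Variables (R : comNzRingType) (I : finType) (V : nmodType) (w : I -> V).
Implicit Types (f g h : fps R I) (m k : monom I) (v : I) (S : set V).

(** Homogeneity, order, growth and the absence of given variables are all of the
form: every monomial that occurs has its weight, for a suitable [w], in a
suitable set. *)
Definition weight m : V := \sum_i w i *+ m i.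

Lemma weight0 : weight (mone I) = 0.
Proof. by rewrite /weight big1 // => i _; rewrite moneE. Qed.

Lemma weightD m k : weight (madd m k) = weight m + weight k.
Proof.
by rewrite /weight -big_split; apply: eq_bigr => i _; rewrite maddE mulrnDr.
Qed.

Lemma weight_var v : weight (mvar v) = w v.
Proof.
rewrite /weight (bigD1 v) //= mvarE eqxx big1 ?addr0 // => i /negPf neq_iv.
by rewrite mvarE neq_iv.
Qed.

Definition weight_in S f := forall m, coef f m != 0 -> S (weight m).

Lemma weight_in_sub S1 S2 f : (forall x, S1 x -> S2 x) ->
  weight_in S1 f -> weight_in S2 f.
Proof. by move=> S12 f1 m /f1/S12. Qed.

Lemma weight_inM S1 S2 S3 f g : (forall x y, S1 x -> S2 y -> S3 (x + y)) ->
  weight_in S1 f -> weight_in S2 g -> weight_in S3 (f * g).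
Proof.
move=> S123 f1 g2 m /coefM_neq0[k le_km [/f1 k1 /g2 k2]].
by rewrite -(msubK le_km) maddC weightD; apply: S123.
Qed.

Lemma weight_in0 S : weight_in S 0.
Proof. by move=> m; rewrite coef0 eqxx. Qed.

Lemma weight_in1 S : S 0 -> weight_in S 1.
Proof.
move=> S0 m; rewrite coef1.
by have [->|_] := eqVneq m (mone I); rewrite ?weight0 ?eqxx.
Qed.

Lemma weight_inD S f g : weight_in S f -> weight_in S g -> weight_in S (f + g).
Proof.
move=> fS gS m; have [f0|/fS//] := eqVneq (coef f m) 0.
by rewrite coefD f0 add0r => /gS.
Qed.

Lemma weight_inN S f : weight_in S f -> weight_in S (- f).
Proof. by move=> fS m; rewrite coefN oppr_eq0 => /fS. Qed.

Lemma weight_inB S f g : weight_in S f -> weight_in S g -> weight_in S (f - g).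
Proof. by move=> fS gS; apply: weight_inD => //; apply: weight_inN. Qed.

Lemma weight_inZ S c f : weight_in S f -> weight_in S (c *: f).
Proof.
move=> fS m; rewrite coefZ => cf0; apply: fS.
by apply: contra_neq cf0 => ->; rewrite mulr0.
Qed.

Lemma weight_in_sum S (J : Type) (s : seq J) (A : pred J) (F : J -> fps R I) :
  (forall j, A j -> weight_in S (F j)) -> weight_in S (\sum_(j <- s | A j) F j).
Proof.
by move=> FS; apply: big_ind => //; [exact: weight_in0 | exact: weight_inD].
Qed.

Lemma weight_in_fps_sum S (J : choiceType) (F : J -> fps R I) :
  (forall j, weight_in S (F j)) -> weight_in S (fps_sum F).
Proof. by move=> FS m /coef_fps_sum_neq0[j /FS]. Qed.

Lemma weight_in_mono S k : S (weight k) -> weight_in S (fps_mono k).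
Proof.
by move=> Sk m; rewrite coef_mono; have [->|_] := eqVneq m k; rewrite ?eqxx.
Qed.

Lemma weight_in_var S v : S (w v) -> weight_in S (fps_var v).
Proof.
by rewrite -weight_var fps_varE; exact: weight_in_mono.
Qed.

Lemma weight_inX S f (k : nat) : S 0 -> (forall x y, S x -> S y -> S (x + y)) ->
  weight_in S f -> weight_in S (f ^+ k).
Proof.
move=> S0 SD fS; elim: k => [|k IHk]; first exact: weight_in1.
by rewrite exprS; apply: weight_inM SD fS IHk.
Qed.

End Support.

Lemma weight_in_exp (I : finType) (V : nmodType) (w : I -> V) (S : set V)
    (h : fps rat I) :
    S 0 -> (forall x y, S x -> S y -> S (x + y)) ->
  weight_in w S h -> weight_in w S (fps_exp h).
Proof.
by move=> *; apply: weight_in_fps_sum => k; apply: weight_inZ; apply: weight_inX.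
Qed.

Section Order.
Variables (R : comNzRingType) (I : finType).
Implicit Types (f g h : fps R I) (m k : monom I) (N : nat).

(** Modulo series of order at least [N], the geometric series of [W] and the
exponential series become finite sums. *)
Definition order_ge N f := forall m, coef f m != 0 -> (N <= mdeg m)%N.

Lemma weight_deg m : weight (fun=> 1%N) m = mdeg m :> nat.
Proof. by rewrite /weight /mdeg; apply: eq_bigr => i _; exact: natn. Qed.

Lemma order_geE N f :
  order_ge N f <-> weight_in (fun=> 1%N) (fun d : nat => N <= d)%N f.
Proof. by split=> fN m /fN; rewrite weight_deg. Qed.

Lemma order_geM N1 N2 f g :
  order_ge N1 f -> order_ge N2 g -> order_ge (N1 + N2) (f * g).
Proof.
rewrite !order_geE; apply: weight_inM => x y; exact: leq_add.
Qed.

Lemma order_geMl N f g : order_ge N g -> order_ge N (f * g).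
Proof. by move=> gN; apply: (@order_geM 0 N). Qed.

Lemma order_geX N f (k : nat) : order_ge N f -> order_ge (N * k) (f ^+ k).
Proof.
move=> fN; elim: k => [|k IHk]; first by rewrite muln0.
by rewrite exprS mulnS; apply: order_geM.
Qed.

Lemma order_ge_sum N (J : Type) (s : seq J) (A : pred J) (F : J -> fps R I) :
  (forall j, A j -> order_ge N (F j)) -> order_ge N (\sum_(j <- s | A j) F j).
Proof.
by move=> FN; rewrite order_geE; apply: weight_in_sum => j /FN; rewrite order_geE.
Qed.

Lemma order_geB N f g : order_ge N f -> order_ge N g -> order_ge N (f - g).
Proof. by rewrite !order_geE; apply: weight_inB. Qed.

Lemma order_geZ N c f : order_ge N f -> order_ge N (c *: f).
Proof. by rewrite !order_geE; apply: weight_inZ. Qed.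

Lemma order_ge_leq N1 N2 f : (N1 <= N2)%N -> order_ge N2 f -> order_ge N1 f.
Proof. by move=> le_N fN m /fN; apply: leq_trans. Qed.

Lemma order_ge1 f : coef f (mone I) = 0 <-> order_ge 1 f.
Proof.
split=> [f0 m|fN]; last first.
  by apply/eqP; apply: contraT => /fN; rewrite mdeg0.
by apply: contraR; rewrite -leqNgt leqn0 => /eqP/mdeg_eq0->; rewrite f0.
Qed.

(** How identities between infinite sums are reduced to truncated ones. *)
Lemma order_ge_eq f g : (forall N, order_ge N (f - g)) -> f = g.
Proof.
move=> fg; apply: fps_eqP => m; apply/eqP; rewrite -subr_eq0 -coefB.
by apply: contraT => /(fg (mdeg m).+1); rewrite ltnn.
Qed.

(** The terms of index at least [N] have no monomial of degree less than [N]. *)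
Lemma order_ge_fps_sum (F : nat -> fps R I) N :
    (forall k : nat, order_ge k (F k)) ->
  order_ge N (fps_sum F - \sum_(k < N) F k).
Proof.
move=> FN m; apply: contraR; rewrite -ltnNge => lt_mN.
rewrite coefB coef_sum -(big_mkord predT (fun k : nat => coef (F k) m)).
rewrite (coef_fps_sum (s := index_iota 0 N)) ?subrr ?iota_uniq // => k /FN le_km.
by rewrite mem_index_iota (leq_ltn_trans le_km).
Qed.

End Order.

(** * Derivations and linear differential systems *)

Definition derivation (A : comNzRingType) (D : A -> A) :=
  {morph D : x y / x + y} /\ forall x y, D (x * y) = D x * y + x * D y.

Section Derivations.
Variables (A : comNzRingType) (D : A -> A).
Variable dD : derivation D.

Lemma derD : {morph D : x y / x + y}. Proof. by case: dD. Qed.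
Lemma derM x y : D (x * y) = D x * y + x * D y. Proof. by case: dD. Qed.

Lemma der0 : D 0 = 0.
Proof. by apply: (addrI (D 0)); rewrite -derD !addr0. Qed.

Lemma derN : {morph D : x / - x}.
Proof. by move=> x; apply: (addrI (D x)); rewrite -derD !subrr der0. Qed.

Lemma der1 : D 1 = 0.
Proof.
by apply: (addrI (D 1)); rewrite addr0 -[in RHS](mulr1 1) derM mulr1 mul1r.
Qed.

Lemma der_sum (J : Type) (s : seq J) (P : pred J) (F : J -> A) :
  D (\sum_(j <- s | P j) F j) = \sum_(j <- s | P j) D (F j).
Proof. exact: (big_morph D derD der0). Qed.

Lemma der_prod0 (J : Type) (s : seq J) (P : pred J) (F : J -> A) :
  (forall j, P j -> D (F j) = 0) -> D (\prod_(j <- s | P j) F j) = 0.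
Proof.
move=> DF0; elim/big_rec: _ => [|j x Pj Dx]; first exact: der1.
by rewrite derM DF0 // Dx mul0r mulr0 addr0.
Qed.

Lemma derX x k : D (x ^+ k) = x ^+ k.-1 * D x *+ k.
Proof.
elim: k => [|k IHk]; first by rewrite der1 mulr0n.
rewrite exprS derM IHk /=; case: k {IHk} => [|k]; rewrite ?mulr0n; first by ring.
by rewrite /= !mulrS exprS -mulrnAr; ring.
Qed.

Lemma der_signr (k : nat) : D ((-1) ^+ k) = 0.
Proof. by rewrite derX derN der1 oppr0 mulr0 mul0rn. Qed.

Lemma der_det0 n (M : 'M[A]_n) : (forall i j, D (M i j) = 0) -> D (\det M) = 0.
Proof.
move=> DM0; rewrite /determinant der_sum big1 // => s _.
by rewrite derM der_signr mul0r add0r der_prod0 // mulr0.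
Qed.

(** The determinant is an affine function of each entry: expand along its row. *)
Lemma der_det_entry n (M : 'M[A]_n) i j :
    (forall k l, (k, l) != (i, j) -> D (M k l) = 0) ->
  D (\det M) = D (M i j) * cofactor M i j.
Proof.
move=> DM0; rewrite (expand_det_row M i) der_sum (bigD1 j) //= big1 ?addr0.
  rewrite derM /cofactor (derM _ (\det _)) der_signr mul0r add0r.
  rewrite der_det0 ?mulr0 ?addr0 // => k l; rewrite !mxE; apply: DM0.
  by rewrite xpair_eqE negb_and eq_sym neq_lift.
move=> l neq_lj; rewrite derM DM0 ?mul0r ?add0r; last first.
  by rewrite xpair_eqE negb_and neq_lj orbT.
rewrite /cofactor derM der_signr mul0r add0r der_det0 ?mulr0 // => k q.
by rewrite !mxE DM0 // xpair_eqE negb_and eq_sym neq_lift.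
Qed.

Lemma der_mulmx m n p (M : 'M[A]_(m, n)) (N : 'M[A]_(n, p)) :
  map_mx D (M *m N) = map_mx D M *m N + M *m map_mx D N.
Proof.
apply/matrixP => i k; rewrite !mxE der_sum -big_split /=.
by apply: eq_bigr => j _; rewrite derM !mxE.
Qed.

(** Differentiate [M * N = 1]. *)
Lemma der_inv n (M N : 'M[A]_n) : M *m N = 1%:M ->
  map_mx D N = - (N *m map_mx D M *m N).
Proof.
move=> MN1; have NM1 := mulmx1C MN1.
have D10 : map_mx D 1%:M = 0 :> 'M[A]_n.
  apply/matrixP => i j; rewrite !mxE; case: (i == j); first exact: der1.
  exact: der0.
have := der_mulmx M N; rewrite MN1 D10 => /eqP.
rewrite eq_sym addrC addr_eq0 => /eqP /(congr1 (mulmx N)).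
by rewrite mulmxA NM1 mul1mx mulmxN mulmxA.
Qed.

(** The cofactor is [\det M * N j i]; differentiate [\det M * \det N = 1]. *)
Lemma der_det_inv n (M N : 'M[A]_n) i j : M *m N = 1%:M ->
    (forall k l, (k, l) != (i, j) -> D (M k l) = 0) ->
  D (\det N) = - (D (M i j) * N j i * \det N).
Proof.
move=> MN1 DM0; have detMN : \det M * \det N = 1 by rewrite -det_mulmx MN1 det1.
have adjM : \adj M = \det M *: N.
  by rewrite -[LHS]mulmx1 -MN1 mulmxA mul_adj_mx mul_scalar_mx.
have cofM : cofactor M i j = \det M * N j i.
  by have /matrixP/(_ j i) := adjM; rewrite !mxE.
have := derM (\det M) (\det N); rewrite detMN der1 (der_det_entry DM0) cofM.
move=> /eqP; rewrite eq_sym addrC addr_eq0 => /eqP /(congr1 ( *%R (\det N))).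
rewrite mulrA (mulrC (\det N)) detMN mul1r => ->.
rewrite mulrN; congr (- _).
have -> : D (M i j) * N j i * \det N =
  D (M i j) * N j i * \det N * (\det M * \det N) by rewrite detMN mulr1.
by ring.
Qed.

(** Stated for any family on which [D] acts as the derivative in the variable of
index [v], so as to cover both the monomials and the substituted monomials. *)
Lemma der_monom (I : finType) (x : I -> A) (k : monom I) (v : I) :
    (forall u, D (x u) = (u == v)%:R) ->
  D (\prod_u x u ^+ k u) = (\prod_u x u ^+ msub k (mvar v) u) *+ k v.
Proof.
move=> Dx; rewrite (bigD1 v) //= derM derX Dx eqxx mulr1 der_prod0 ?mulr0 ?addr0.
  rewrite [in RHS](bigD1 v) //= !monomE eqxx subn1 -mulrnAl; congr (_ * _).
  by apply: eq_bigr => u /negPf neq_uv; rewrite !monomE neq_uv subn0.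
by move=> u /negPf neq_uv; rewrite derX Dx neq_uv mulr0 mul0rn.
Qed.

Lemma der_monom0 (I : finType) (x : I -> A) (k : monom I) :
    (forall u, k u != 0%N -> D (x u) = 0) ->
  D (\prod_u x u ^+ k u) = 0.
Proof.
move=> Dx; apply: der_prod0 => u _; have [->|ku] := eqVneq (k u) 0%N.
  exact: der1.
by rewrite derX Dx // mulr0 mul0rn.
Qed.

End Derivations.

Section PartialDerivatives.
Variables (R : comNzRingType) (I : finType).
Implicit Types (f g h : fps R I) (m k : monom I) (v u : I).

Definition partial v f : fps R I :=
  Fps (fun m => coef f (madd m (mvar v)) *+ (m v).+1).

Lemma coef_partial v f m :
  coef (partial v f) m = coef f (madd m (mvar v)) *+ (m v).+1.
Proof. by []. Qed.

Definition euler v f : fps R I := Fps (fun m => coef f m *+ m v).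

Lemma euler_partial v f : euler v f = fps_var v * partial v f.
Proof.
apply: fps_eqP => m; rewrite coef_varM /=; case: ltnP => [m_v|]; last first.
  by rewrite leqn0 => /eqP->.
rewrite msubK ?mle_var //; congr (_ *+ _).
by rewrite !monomE eqxx subn1 prednK.
Qed.

Lemma eulerM v f g : euler v (f * g) = euler v f * g + f * euler v g.
Proof.
apply: fps_eqP => m; rewrite coefD !coefM /= -big_split -sumrMnl /=.
rewrite big_seq [RHS]big_seq; apply: eq_bigr => k; rewrite mem_mdivisors => /mleP.
by move=> /(_ v) le_kv; rewrite mulrnAl mulrnAr -mulrnDr msubE subnKC.
Qed.

(** The Leibniz rule is immediate for the Euler operator [x_v d/dx_v], which
multiplies each monomial by its degree in [v]; divide by [x_v]. *)
Lemma partial_derivation v : derivation (partial v).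
Proof.
split=> f g; first by apply: fps_eqP => m; rewrite /= mulrnDl.
apply: (@fps_var_lreg R I v); rewrite -euler_partial eulerM !euler_partial.
by ring.
Qed.

Lemma partial_var v u : partial v (fps_var u) = (u == v)%:R.
Proof.
apply: fps_eqP => m; rewrite coef_partial fps_varE coef_mono.
have [->|neq_uv] := eqVneq u v; last first.
  case: eqP => [/ffunP/(_ v)|]; rewrite ?mul0rn // !monomE eqxx.
  by rewrite eq_sym (negPf neq_uv) addn1.
rewrite coef1; have [->|m_neq0] := eqVneq m (mone I).
  by rewrite madd0m eqxx moneE.
case: eqP => [|_]; last by rewrite mul0rn.
by rewrite -[in RHS](madd0m (mvar v)) => /maddIr/eqP; rewrite (negPf m_neq0).
Qed.

Lemma order_ge_partial N v f : order_ge N.+1 f -> order_ge N (partial v f).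
Proof.
move=> fN m; rewrite coef_partial => Dfm.
have := fN (madd m (mvar v)); rewrite mdegD mdeg_var addn1 ltnS; apply.
by apply: contra_neq Dfm => ->; rewrite mul0rn.
Qed.

Lemma partialZ v c f : partial v (c *: f) = c *: partial v f.
Proof. by apply: fps_eqP => m; rewrite /= mulrnAr. Qed.

End PartialDerivatives.

(** The equation for the derivative in [v] expresses the coefficient of a
monomial divisible by [v] through those of smaller degree, after a division by
the exponent of [v]. *)
Lemma partial_system_unique (R : numDomainType) (I : finType) (f g : fps R I)
    (c : I -> fps R I) :
    (forall v, partial v f = c v * f) -> (forall v, partial v g = c v * g) ->
    coef f (mone I) = coef g (mone I) ->
  f = g.
Proof.
move=> Df Dg fg0; apply: order_ge_eq; elim=> [//|N IHN].
move=> m; elim/monom_ind: m => [|m v _]; first by rewrite coefB fg0 subrr eqxx.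
have Dfg : partial v (f - g) = c v * (f - g).
  have dv := partial_derivation R v.
  by rewrite (derD dv) (derN dv) Df Dg mulrBr.
move=> fg_neq0; rewrite mdegD mdeg_var addn1 ltnS.
apply: (order_geMl (f := c v) IHN); rewrite -Dfg coef_partial.
by rewrite mulrn_eq0 (negPf fg_neq0).
Qed.

Section Exponential.
Variables (I : finType) (h : fps rat I).
Variable h0 : coef h (mone I) = 0.

Lemma order_ge_exp_terms k : order_ge k ((k`!%:R)^-1 *: h ^+ k).
Proof.
by apply: order_geZ; rewrite -[k in order_ge k]mul1n; apply/order_geX/order_ge1.
Qed.

Lemma coef0_exp : coef (fps_exp h) (mone I) = 1.
Proof.
rewrite (coef_fps_sum (s := [:: 0%N])) // => [|k /order_ge_exp_terms].
  by rewrite big_seq1 coefZ expr0 coef1 eqxx fact0 invr1 mulr1.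
by rewrite mdeg0 leqn0 inE.
Qed.

(** Term by term differentiation shifts the exponential series by one, and the
derivative lowers the order by at most one: compare the truncations at [N.+1]
and [N]. *)
Lemma partial_exp v : partial v (fps_exp h) = partial v h * fps_exp h.
Proof.
pose T N := \sum_(k < N) (k`!%:R)^-1 *: h ^+ k.
have dv := partial_derivation rat v.
have DT N : partial v (T N.+1) = partial v h * T N.
  rewrite /T big_ord_recl (derD dv) (der_sum dv) partialZ expr0 (der1 dv).
  rewrite scaler0 add0r.
  rewrite mulr_sumr; apply: eq_bigr => k _; rewrite lift0.
  rewrite partialZ (derX dv) [RHS]mulrC fps_scaleAl -scaler_nat scalerA.
  congr (_ *: _); rewrite factS natrM invfM mulrAC mulVf ?mul1r //.
  by rewrite pnatr_eq0.
apply: order_ge_eq => N.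
have -> : partial v (fps_exp h) - partial v h * fps_exp h =
    partial v (fps_exp h - T N.+1) - partial v h * (fps_exp h - T N).
  by rewrite (derD dv) (derN dv) DT; ring.
apply: order_geB; last by apply/order_geMl/order_ge_fps_sum/order_ge_exp_terms.
by apply/order_ge_partial/order_ge_fps_sum/order_ge_exp_terms.
Qed.

End Exponential.

(** * Contraction of tame series *)

Section ContractionTheory.
Variable n : nat.
Implicit Types (f h c : Qseries n) (m : monom (var n)) (k : monom 'I_n).
Implicit Types (v : var n) (i : 'I_n).

Definition mfree m := [forall v, is_r_or_s v ==> (m v == 0%N)].

Lemma mfreeP m : reflect (forall v, is_r_or_s v -> m v = 0%N) (mfree m).
Proof.
apply: (iffP forallP) => m0 v; last by apply/implyP => /m0->.
by have /implyP m0v := m0 v => /m0v/eqP.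
Qed.

Definition rs_degree (v : var n) : nat := is_r_or_s v.
Definition rs_free h := weight_in rs_degree (fun d : nat => d = 0%N) h.

Lemma mfree_weight m : mfree m <-> weight rs_degree m = 0%N.
Proof.
rewrite /weight; split=> [/mfreeP m0|/eqP].
  rewrite big1 // => v _; rewrite /rs_degree.
  by case: (boolP (is_r_or_s v)) => [/m0->|_]; rewrite ?mulr0n ?mul0rn.
have -> : (\sum_v rs_degree v *+ m v)%R = (\sum_v rs_degree v * m v)%N.
  by apply: eq_bigr => v _; rewrite -mulr_natr natn.
rewrite sum_nat_eq0 => /forallP m0; apply/mfreeP => v rs_v.
by have := m0 v; rewrite /rs_degree rs_v mul1n => /eqP.
Qed.

Lemma rs_freeP h : rs_free h <-> forall m, coef h m != 0 -> mfree m.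
Proof. by split=> h0 m /h0 /mfree_weight. Qed.

Lemma coef_nfree h m : rs_free h -> ~~ mfree m -> coef h m = 0.
Proof. by move=> /rs_freeP h_free; apply: contraNeq; apply: h_free. Qed.

Lemma mfreeD m1 m2 : mfree (madd m1 m2) = mfree m1 && mfree m2.
Proof.
apply/mfreeP/andP => [m0|[/mfreeP m10 /mfreeP m20] v rs_v]; last first.
  by rewrite maddE m10 ?m20.
by split; apply/mfreeP => v /m0/eqP; rewrite maddE addn_eq0 => /andP[/eqP? /eqP?].
Qed.

Lemma mfree_sub m1 m2 : mfree m1 -> mfree (msub m1 m2).
Proof. by move=> /mfreeP m0; apply/mfreeP => v /m0 m1v; rewrite msubE m1v. Qed.

Lemma rs_free_var v : ~~ is_r_or_s v -> rs_free (fps_var v).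
Proof. by move=> nrs_v; apply: weight_in_var; rewrite /rs_degree (negPf nrs_v). Qed.

Lemma rs_freeM f h : rs_free f -> rs_free h -> rs_free (f * h).
Proof. by apply: weight_inM => x y -> ->. Qed.

(** The variables other than [r] and [s] have weight -2, since the monomials of
[rWs] contain two variables among [r] and [s] for a single other one. *)
Definition growth (v : var n) : int := if is_r_or_s v then 1 else - 2%:Z.
(** A ring of series on which contraction is always defined.  The Gaussian
belongs to it, with bound 0. *)
Definition tame h := exists C : int, weight_in growth (fun x => x <= C) h.

Lemma tameD f h : tame f -> tame h -> tame (f + h).
Proof.
move=> [C1 fC] [C2 hC]; exists (Num.max C1 C2).
apply: weight_inD; [apply: weight_in_sub fC|apply: weight_in_sub hC] => x;
  by rewrite le_max => ->; rewrite ?orbT.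
Qed.

Lemma tameM f h : tame f -> tame h -> tame (f * h).
Proof.
move=> [C1 fC] [C2 hC]; exists (C1 + C2); apply: weight_inM fC hC => x y.
exact: lerD.
Qed.

Lemma tame0 : tame 0. Proof. by exists 0; exact: weight_in0. Qed.
Lemma tame1 : tame 1. Proof. by exists 0; exact: weight_in1. Qed.

Lemma tameX f (k : nat) : tame f -> tame (f ^+ k).
Proof.
by move=> fT; elim: k => [|k IHk]; [exact: tame1 | rewrite exprS; apply: tameM].
Qed.

Lemma tameZ x f : tame f -> tame (x *: f).
Proof. by move=> [C fC]; exists C; apply: weight_inZ. Qed.

Lemma tame_sum (J : Type) (s : seq J) (P : pred J) (F : J -> Qseries n) :
  (forall j, P j -> tame (F j)) -> tame (\sum_(j <- s | P j) F j).
Proof. by move=> FT; apply: big_ind => //; [exact: tame0 | exact: tameD]. Qed.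

Lemma tame_prod (J : Type) (s : seq J) (P : pred J) (F : J -> Qseries n) :
  (forall j, P j -> tame (F j)) -> tame (\prod_(j <- s | P j) F j).
Proof. by move=> FT; apply: big_ind => //; [exact: tame1 | exact: tameM]. Qed.

Lemma tame_var v : tame (fps_var v).
Proof. by exists (growth v); apply: weight_in_var. Qed.

Lemma growth_free m : mfree m -> weight growth m <= 0.
Proof.
move=> /mfreeP m0; apply: sumr_le0 => v _; rewrite /growth.
by case: ifP => [/m0->|_]; rewrite ?mulr0n // mulrn_wle0.
Qed.

Lemma tame_free h : rs_free h -> tame h.
Proof.
by move=> /rs_freeP h0; exists 0 => m /h0/growth_free.
Qed.

Lemma tame_partial v h : tame h -> tame (partial v h).
Proof.
move=> [C hC]; exists (C - growth v) => m; rewrite coef_partial => Dh.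
have /hC : coef h (madd m (mvar v)) != 0.
  by apply: contra_neq Dh => ->; rewrite mul0rn.
by rewrite weightD weight_var lerBrDr.
Qed.

Lemma rs_monomD k1 l1 k2 l2 :
  rs_monom (madd k1 k2) (madd l1 l2) = madd (rs_monom k1 l1) (rs_monom k2 l2).
Proof. by apply/ffunP => -[i|i|i|i|i j]; rewrite !ffunE. Qed.

Lemma growth_rs_monom k i : (k i)%:Z <= weight growth (rs_monom k k).
Proof.
rewrite /weight (bigD1 (Vr i)) //= ffunE /growth /= -[leLHS]addr0 lerD //.
  by rewrite natz.
by apply: sumr_ge0 => -[j|j|j|j|j l] _; rewrite ffunE ?mulr0n ?mulrn_wge0.
Qed.

Definition box N : seq (monom 'I_n) := mdivisors [ffun=> N].

Lemma mem_box N k : (k \in box N) = [forall i, (k i <= N)%N].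
Proof.
rewrite mem_mdivisors; apply/forallP/forallP => le_kN i.
  by have := le_kN i; rewrite ffunE.
by rewrite ffunE.
Qed.

Lemma box_uniq N : uniq (box N). Proof. exact: mdivisors_uniq. Qed.

(** For a given monomial in the other variables, bounded growth leaves finitely
many powers of [r] and [s].  The bound is uniform over the divisors of [m], as
required for products. *)
Lemma tame_box h m : tame h -> exists N0, forall N, (N0 <= N)%N ->
  forall m' k, mle m' m -> coef h (madd m' (rs_monom k k)) != 0 -> k \in box N.
Proof.
move=> [C hC].
(* The monomial [m'] has weight at least [- 2 * mdeg m], so the weight of
   [rs_monom k k], which bounds each [k i], is at most [C + 2 * mdeg m]. *)
exists (`|C| + 2 * mdeg m)%N => N le_N m' k le_m' /hC.
rewrite weightD => le_C; rewrite mem_box; apply/forallP => i.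
have := growth_rs_monom k i.
have le_deg : - (2 * mdeg m')%N%:Z <= weight growth m'.
  elim/monom_ind: {le_m' le_C} m' => [|m' v IHm]; first by rewrite weight0 mdeg0.
  rewrite weightD weight_var mdegD mdeg_var mulnDr PoszD opprD lerD //.
  by rewrite /growth; case: ifP.
have := mdegB le_m'; lia.
Qed.

Lemma coef_contraction_terms h k m : coef (contraction_terms h k) m =
  (\prod_i (k i)`!)%:R * (if mfree m then coef h (madd m (rs_monom k k)) else 0).
Proof. by []. Qed.

Lemma coef_contraction h m s : uniq s -> mfree m ->
    (forall k, coef h (madd m (rs_monom k k)) != 0 -> k \in s) ->
  coef (contraction h) m =
    \sum_(k <- s) (\prod_i (k i)`!)%:R * coef h (madd m (rs_monom k k)).
Proof.
move=> s_uniq m_free supp_s; rewrite (coef_fps_sum s_uniq) => [|k].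
  by apply: eq_bigr => k _; rewrite coefZ /= -/(mfree m) m_free.
rewrite coefZ /= -/(mfree m) m_free => hk; apply: supp_s.
by apply: contra_neq hk => ->; rewrite mulr0.
Qed.

Lemma contraction_free h : rs_free (contraction h).
Proof.
apply/rs_freeP => m /coef_fps_sum_neq0[k]; rewrite coefZ /= -/(mfree m).
by case: ifP => // _; rewrite mulr0 eqxx.
Qed.

Lemma eq_contraction f h m :
    (forall k, mfree m ->
      coef f (madd m (rs_monom k k)) = coef h (madd m (rs_monom k k))) ->
  coef (contraction f) m = coef (contraction h) m.
Proof.
move=> eq_fh; apply: eq_fsbigr => k _; rewrite !coefZ /= -/(mfree m).
by case: ifP => // /eq_fh->.
Qed.

Lemma contractionD f h : tame f -> tame h ->
  contraction (f + h) = contraction f + contraction h.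
Proof.
move=> fT hT; apply: fps_eqP => m; rewrite coefD.
have [m_free|nfree] := boolP (mfree m); last first.
  by rewrite !coef_nfree ?addr0 //; exact: contraction_free.
have [N1 fN] := tame_box m fT; have [N2 hN] := tame_box m hT.
have le_mm : mle m m by apply/mleP.
have N1P k := fN _ (leq_maxl N1 N2) m k le_mm.
have N2P k := hN _ (leq_maxr N1 N2) m k le_mm.
rewrite !(@coef_contraction _ _ (box (maxn N1 N2))) ?box_uniq //.
  by rewrite -big_split; apply: eq_bigr => k _; rewrite coefD mulrDr.
move=> k; have [f0|/N1P//] := eqVneq (coef f (madd m (rs_monom k k))) 0.
by rewrite coefD f0 add0r => /N2P.
Qed.

Lemma contractionZ x h : contraction (x *: h) = x *: contraction h.
Proof.
have [->|x_neq0] := eqVneq x 0.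
  rewrite !scale0r; apply: fps_eqP => m; rewrite coef0 /= fsbig1 // => k _.
  by case: ifP; rewrite mulr0.
apply: fps_eqP => m; rewrite coefZ /= mulr_fsumr; apply: eq_fsbigr => k _.
by case: ifP; rewrite ?mulr0 // mulrCA.
Qed.

Lemma contraction0 : contraction (0 : Qseries n) = 0.
Proof. by rewrite -[0 in LHS](scale0r 0) contractionZ scale0r. Qed.

Lemma contraction_sum (J : Type) (s : seq J) (P : pred J) (F : J -> Qseries n) :
    (forall j, P j -> tame (F j)) ->
  contraction (\sum_(j <- s | P j) F j) = \sum_(j <- s | P j) contraction (F j).
Proof.
move=> FT.
suff [] : tame (\sum_(j <- s | P j) F j) /\ contraction (\sum_(j <- s | P j) F j) =
  \sum_(j <- s | P j) contraction (F j) by [].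
elim/big_rec2: _ => [|j x y Pj [yT <-]].
  by split; [exact: tame0 | exact: contraction0].
by split; [apply: tameD | apply: contractionD] => //; exact: FT.
Qed.

(** A factor free of [r] and [s] only uses up the part [m] of the monomial. *)
Lemma coef_freeM c h m k : rs_free c -> mfree m ->
  coef (c * h) (madd m (rs_monom k k)) =
  \sum_(j <- mdivisors m) coef c j * coef h (madd (msub m j) (rs_monom k k)).
Proof.
move=> /rs_freeP c_free m_free; rewrite coefM; set M := madd m _.
have le_free j : mle j M -> mfree j -> mle j m.
  move=> /mleP le_jM /mfreeP j_free; apply/mleP => v.
  have [/j_free->//|nrs_v] := boolP (is_r_or_s v).
  have := le_jM v; rewrite maddE; case: (v) nrs_v => [i|i|i|i|i l] //= _;
  by rewrite ffunE addn0.
have -> : \sum_(j <- mdivisors M) coef c j * coef h (msub M j) =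
    \sum_(j <- mdivisors M | mle j m) coef c j * coef h (msub M j).
  rewrite [RHS]big_mkcond big_seq [RHS]big_seq; apply: eq_bigr => j.
  rewrite mem_mdivisors => le_jM; case: ifPn => // nle_jm.
  have [->|/c_free/(le_free j le_jM)] := eqVneq (coef c j) 0; rewrite ?mul0r //.
  by rewrite (negPf nle_jm).
rewrite -big_filter (perm_big (mdivisors m)) /=.
  rewrite big_seq [RHS]big_seq; apply: eq_bigr => j; rewrite mem_mdivisors.
  move=> /mleP le_jm; congr (_ * coef h _); apply/ffunP => v.
  by rewrite !monomE addnBAC.
apply: uniq_perm; rewrite ?filter_uniq ?mdivisors_uniq // => j.
rewrite mem_filter !mem_mdivisors andb_idr // => /mleP le_jm; apply/mleP => v.
by rewrite maddE (leq_trans (le_jm v)) ?leq_addr.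
Qed.

Lemma contraction_freeM c h : rs_free c -> tame h ->
  contraction (c * h) = c * contraction h.
Proof.
move=> c_free hT; apply: fps_eqP => m.
have [m_free|nfree] := boolP (mfree m); last first.
  by rewrite !coef_nfree //; [apply: rs_freeM => // |]; exact: contraction_free.
have [N0 /(_ N0 (leqnn _)) hN] := tame_box m hT.
rewrite (@coef_contraction _ _ (box N0)) ?box_uniq //; last first.
  move=> k; rewrite coef_freeM // => ch.
  have [j [le_jm hj]] : exists j, mle j m /\
      coef h (madd (msub m j) (rs_monom k k)) != 0.
    apply: contra_notP (negP ch) => /forallNP no_j; apply/eqP; rewrite big_seq.
    rewrite big1 // => j; rewrite mem_mdivisors => le_jm; apply/eqP.
    rewrite mulf_eq0; apply/orP; right; apply/negPn/negP => hj.
    by case: (no_j j).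
  apply: hN hj; apply/mleP => v; rewrite msubE; exact: leq_subr.
rewrite [RHS]coefM; under eq_bigr => k _ do rewrite coef_freeM // big_distrr.
rewrite exchange_big; apply: eq_bigr => j _.
rewrite (@coef_contraction _ _ (box N0)) ?box_uniq ?mfree_sub //; last first.
  move=> k; apply: hN; apply/mleP => v; rewrite msubE; exact: leq_subr.
by rewrite big_distrr; apply: eq_bigr => k _; rewrite /= mulrCA.
Qed.

Lemma partial_free v c : is_r_or_s v -> rs_free c -> partial v c = 0.
Proof.
move=> rs_v /rs_freeP c_free; apply: fps_eqP => m; rewrite coef_partial.
have [->|/c_free/mfreeP/(_ v rs_v)] := eqVneq (coef c (madd m (mvar v))) 0.
  by rewrite mul0rn.
by rewrite maddE mvarE eqxx addn1.
Qed.

Lemma rs_free_partial v c : rs_free c -> rs_free (partial v c).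
Proof.
move=> /rs_freeP c_free; apply/rs_freeP => m; rewrite coef_partial => Dc.
have : mfree (madd m (mvar v)).
  by apply: c_free; apply: contra_neq Dc => ->; rewrite mul0rn.
by rewrite mfreeD => /andP[].
Qed.

Lemma mfree_var v : mfree (mvar v) = ~~ is_r_or_s v.
Proof.
apply/mfreeP/idP => [m0|nrs_v u rs_u].
  by apply/negP => /m0; rewrite mvarE eqxx.
by rewrite mvarE; case: eqP rs_u nrs_v => [->->|].
Qed.

Lemma partial_contraction v h : ~~ is_r_or_s v -> tame h ->
  partial v (contraction h) = contraction (partial v h).
Proof.
move=> nrs_v hT; apply: fps_eqP => m.
have [m_free|nfree] := boolP (mfree m); last first.
  by rewrite !coef_nfree //; [|apply: rs_free_partial]; exact: contraction_free.
have le_mm (j : monom (var n)) : mle j j by apply/mleP.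
have [N0 /(_ N0 (leqnn _)) hN] := tame_box (madd m (mvar v)) hT.
have coefDh k : coef (partial v h) (madd m (rs_monom k k)) =
    coef h (madd (madd m (mvar v)) (rs_monom k k)) *+ (m v).+1.
  rewrite coef_partial maddAC; congr (_ *+ _.+1); rewrite maddE.
  by case: (v) nrs_v => [i|i|i|i|i j] //= _; rewrite ffunE addn0.
rewrite coef_partial !(@coef_contraction _ _ (box N0)) ?box_uniq //.
- rewrite -sumrMnl; apply: eq_bigr => k _; rewrite coefDh.
  by rewrite mulrnAr.
- move=> k; rewrite coefDh => hk; apply: (hN _ _ (le_mm _)).
  by apply: contra_neq hk => ->; rewrite mul0rn.
- by rewrite mfreeD m_free mfree_var.
by move=> k; apply: hN.
Qed.

(** Contraction pairs [r_i ^ k] with [s_i ^ k] with the factor [k!].  Multiplying by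
[r_i] shifts one of the two exponents, and [k.+1`! = k.+1 * k`!] turns the shift
into the derivative with respect to the partner variable. *)
Lemma contraction_var i x y h : x = Vr i /\ y = Vs i \/ x = Vs i /\ y = Vr i ->
  tame h -> contraction (fps_var x * h) = contraction (partial y h).
Proof.
move=> xy hT; apply: fps_eqP => m.
have [m_free|nfree] := boolP (mfree m); last first.
  by rewrite !coef_nfree //; exact: contraction_free.
have mx k : madd m (rs_monom k k) x = k i.
  rewrite maddE; move/mfreeP: m_free.
  by case: xy => -[-> _] ->; rewrite ?ffunE.
have my k : madd m (rs_monom k k) y = k i.
  rewrite maddE; move/mfreeP: m_free.
  by case: xy => -[_ ->] ->; rewrite ?ffunE.
have rs_xy : rs_monom (mvar i) (mvar i) = madd (mvar x) (mvar y).
  apply/ffunP => u; rewrite maddE !mvarE ffunE.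
  by case: xy => -[-> ->]; case: u => [j|j|j|j|j l];
    rewrite ?mvarE -!(inj_eq (can_inj (@var_codeK n))) /= ?eqE /= ?addn0.
pose up k := madd k (mvar i).
have coefS k : coef (fps_var x * h) (madd m (rs_monom (up k) (up k))) =
    coef h (madd (madd m (rs_monom k k)) (mvar y)).
  rewrite /up rs_monomD rs_xy (maddC (mvar x)) !maddA fps_varE.
  exact: coef_monoMD.
have [N0 /(_ N0 (leqnn _)) hN] := tame_box m (tame_partial y hT).
have le_mm : mle m m by apply/mleP.
(* The left-hand terms with [k i = 0] vanish; the others are enumerated by the
   shift of the box used for the right-hand side. *)
pose s := [seq up k | k <- box N0].
rewrite (@coef_contraction _ _ s) //.
- rewrite (@coef_contraction _ _ (box N0)) ?box_uniq //; last first.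
    by move=> k; apply: hN.
  rewrite big_map; apply: eq_bigr => k _; rewrite coefS coef_partial my.
  rewrite -[_ *+ (k i).+1]mulr_natl mulrA -natrM; congr (_%:R * _).
  rewrite (bigD1 i) //= [in RHS](bigD1 i) //= !monomE eqxx addn1 factS.
  rewrite (eq_bigr (fun j => (k j)`!)) => [|j /negPf neq_ji]; last first.
    by rewrite !monomE neq_ji addn0.
  by rewrite -mulnA mulnC.
- by rewrite map_inj_uniq ?box_uniq // => k1 k2; exact: maddIr.
move=> k; rewrite coef_varM mx; case: ifP => // k_i hk.
have -> : k = up (msub k (mvar i)) by rewrite /up msubK ?mle_var.
apply: map_f; apply: hN le_mm _; rewrite coef_partial mulrn_eq0 /= -coefS.
by rewrite /up msubK ?mle_var // coef_varM mx k_i.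
Qed.

End ContractionTheory.

(** * The propagator *)

Lemma sum_delta_mul (A : comNzRingType) (J : finType) (F : J -> A) i :
  \sum_j (j == i)%:R * F j = F i.
Proof.
rewrite (bigD1 i) //= eqxx mul1r big1 ?addr0 // => j /negPf->.
by rewrite mul0r.
Qed.

Lemma sum_mul_delta (A : comNzRingType) (J : finType) (F : J -> A) i :
  \sum_j F j * (j == i)%:R = F i.
Proof. by under eq_bigr => j _ do rewrite mulrC; apply: sum_delta_mul. Qed.

(** Sealed, like the propagator and the Gaussian below: otherwise unification
tries to settle whether two distinct variables agree by unfolding the
enumeration of their exponent vectors. *)
HB.lock Definition xvar (n : nat) (v : var n) : Qseries n := fps_var v.
Canonical xvar_unlockable := Unlockable xvar.unlock.

HB.lock Definition propagator (n : nat) : 'M[Qseries n]_n := Wt.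
Canonical propagator_unlockable := Unlockable propagator.unlock.

Lemma sum_0mul (A : comNzRingType) (J : finType) (F : J -> A) :
  \sum_j 0%:R * F j = 0.
Proof. by rewrite big1 // => j _; rewrite mul0r. Qed.

Lemma sum_mul0 (A : comNzRingType) (J : finType) (F : J -> A) :
  \sum_j F j * 0%:R = 0.
Proof. by rewrite big1 // => j _; rewrite mulr0. Qed.

Section Propagator.
Variable n : nat.
Implicit Types (i j k l : 'I_n) (v : var n).

Local Notation G := (propagator n).

Definition wmatrix : 'M[Qseries n]_n := \matrix_(i, j) xvar (VW i j).
Local Notation x_ := (@xvar n).

Lemma xvarE v : x_ v = fps_mono (mvar v).
Proof. by rewrite unlock. Qed.

Lemma partial_xvar v u : partial v (x_ u) = (u == v)%:R.
Proof. by rewrite unlock partial_var. Qed.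

Lemma weight_in_xvar (V : nmodType) (w : var n -> V) (S : set V) v :
  S (w v) -> weight_in w S (x_ v).
Proof. by rewrite unlock; apply: weight_in_var. Qed.

Lemma var_eqE (u v : var n) : (u == v) = (var_code u == var_code v).
Proof. by rewrite (inj_eq (can_inj (@var_codeK n))). Qed.

Local Notation W := wmatrix.

Lemma wmatrixE : wmatrix = W_.
Proof. by apply/matrixP => i j; rewrite !mxE unlock. Qed.

Lemma propagatorE i j : G i j = fps_sum (fun k : nat => (W ^+ k) i j).
Proof. by rewrite wmatrixE unlock mxE. Qed.

Lemma mxpowS (k : nat) i j :
  (W ^+ k.+1) i j = \sum_l x_ (VW i l) * (W ^+ k) l j.
Proof. by rewrite exprS mxE; apply: eq_bigr => l _; rewrite mxE. Qed.

Lemma mxpow0 i j : (W ^+ 0) i j = (i == j)%:R.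
Proof. by rewrite expr0 mxE. Qed.

Lemma order_ge_mxpow (k : nat) i j : order_ge k ((W ^+ k) i j).
Proof.
elim: k i j => [//|k IHk] i j; rewrite mxpowS; apply: order_ge_sum => l _.
apply: (@order_geM _ _ 1) (IHk l j); apply/order_ge1; rewrite xvarE coef_mono.
case: eqP => // /(congr1 (@mdeg _)); by rewrite mdeg0 mdeg_var.
Qed.

(** Multiplication by [W] raises the order and shifts the partial sums of the
geometric series by one. *)
Lemma propagator_eq : (1%:M - W) *m G = 1%:M.
Proof.
rewrite mulmxBl mul1mx; apply/matrixP => i j.
rewrite !mxE.
pose T N i := \sum_(k < N) (W ^+ k) i j.
have TS N : T N.+1 i = (i == j)%:R + \sum_l x_ (VW i l) * T N l.
  rewrite /T big_ord_recl mxpow0; congr (_ + _).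
  under eq_bigr => k _ do rewrite lift0 mxpowS.
  by rewrite exchange_big; apply: eq_bigr => l _; rewrite mulr_sumr.
have Tapprox N l : order_ge N (G l j - T N l).
  by rewrite propagatorE; apply/order_ge_fps_sum => k; apply: order_ge_mxpow.
apply: order_ge_eq => N.
have -> : G i j - \sum_l W i l * G l j -
      (i == j)%:R = (G i j - T N.+1 i) - \sum_l x_ (VW i l) * (G l j - T N l).
  have -> : \sum_l x_ (VW i l) * (G l j - T N l) =
      \sum_l W i l * G l j - \sum_l x_ (VW i l) * T N l.
    by rewrite -sumrB; apply: eq_bigr => l _; rewrite [W i l]mxE mulrBr.
  by rewrite TS; ring.
apply: order_geB; first exact: order_ge_leq (Tapprox N.+1 i).
by apply: order_ge_sum => l _; apply: order_geMl.
Qed.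

(** The entry [(i, j)] is the sum over the paths from [i] to [j] of the products
of the [W] along the edges, so that its weights are those of paths. *)
Lemma weight_in_propagator (V : nmodType) (w : var n -> V)
    (S : 'I_n -> 'I_n -> set V) i j :
    (forall i, S i i 0) ->
    (forall i j k x, S j k x -> S i k (w (VW i j) + x)) ->
  weight_in w (S i j) (G i j).
Proof.
move=> S0 SW; rewrite propagatorE; apply: weight_in_fps_sum => k.
elim: k i => [|k IHk] i.
  rewrite mxpow0; case: eqP => [->|_]; first exact: weight_in1.
  exact: weight_in0.
rewrite mxpowS; apply: weight_in_sum => l _.
apply: (weight_inM (S1 := eq^~ (w (VW i l)))) (IHk l).
  by move=> x y -> /SW.
exact: weight_in_xvar.
Qed.

Lemma rs_free_propagator i j : rs_free (G i j).
Proof. exact: (weight_in_propagator (S := fun _ _ x => x = 0)). Qed.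

Lemma partial_one_sub_W v i j :
  partial v ((1%:M - W) i j) = - (VW i j == v)%:R.
Proof.
have dv := partial_derivation rat v.
rewrite !mxE (derD dv) (derN dv) partial_xvar.
by case: (i == j); rewrite ?(der1 dv) ?(der0 dv) add0r.
Qed.

Lemma partial_propagator_W i j k l :
  partial (VW i j) (G k l) = G k i * G j l.
Proof.
have dv := partial_derivation rat (VW i j).
have /matrixP/(_ k l) := der_inv dv propagator_eq; rewrite [in LHS]mxE => ->.
have -> : map_mx (partial (VW i j)) (1%:M - W) = - delta_mx i j.
  apply/matrixP => p q; rewrite mxE partial_one_sub_W !mxE.
  by rewrite var_eqE.
rewrite mulmxN mulNmx opprK -(mul_delta_mx (0 : 'I_1)) mulmxA -colE -mulmxA -rowE.
by rewrite mxE big_ord1 !mxE.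
Qed.

Lemma partial_propagator v i j : (forall k l, v != VW k l) ->
  partial v (G i j) = 0.
Proof.
move=> vW; have dv := partial_derivation rat v.
have /matrixP/(_ i j) := der_inv dv propagator_eq; rewrite [in LHS]mxE => ->.
have -> : map_mx (partial v) (1%:M - W) = 0.
  apply/matrixP => p q; rewrite mxE partial_one_sub_W !mxE.
  by rewrite eq_sym (negPf (vW p q)) oppr0.
by rewrite mulmx0 mul0mx oppr0 mxE.
Qed.

(** Jacobi's formula for [1 - W], of which exactly one entry involves the
variable [W_ij]. *)
Lemma partial_det_propagator_W i j :
  partial (VW i j) (\det G) = G j i * \det G.
Proof.
have dv := partial_derivation rat (VW i j).
rewrite (der_det_inv dv (i := i) (j := j) propagator_eq) => [|k l neq_kl].
  by rewrite partial_one_sub_W eqxx mulN1r mulNr opprK.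
by rewrite partial_one_sub_W var_eqE -[_ == _]/((k, l) == (i, j)) (negPf neq_kl) oppr0.
Qed.

Lemma partial_det_propagator v : (forall k l, v != VW k l) ->
  partial v (\det G) = 0.
Proof.
move=> vW; apply: (der_det0 (partial_derivation rat v)) => k l.
exact: partial_propagator.
Qed.

(** The constant term is a ring morphism, and it maps [1 - W] to 1. *)
Lemma coef0_det_propagator : coef (\det G) (mone _) = 1.
Proof.
pose c0 (f : Qseries n) := coef f (mone _).
have coef0W : map_mx c0 (1%:M - W) = 1%:M.
  apply/matrixP => i j; rewrite !mxE /c0 coefB xvarE coef_mono.
  rewrite [mone _ == _](_ : _ = false) ?subr0; last first.
    by apply/eqP => /(congr1 (@mdeg _)); rewrite mdeg0 mdeg_var.
  by case: (i == j); rewrite ?coef1 ?eqxx.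
have c01 : c0 1 = 1 by rewrite /c0 coef1 eqxx.
have coef0_prod (F : 'I_n -> Qseries n) : c0 (\prod_i F i) = \prod_i c0 (F i).
  exact: (big_morph c0 (fun f g => coef0M f g) c01).
have coef0_det (M : 'M[Qseries n]_n) : c0 (\det M) = \det (map_mx c0 M).
  rewrite /c0 coef_sum; apply: eq_bigr => s _; rewrite coef0M; congr (_ * _).
    by case: (odd_perm s); rewrite ?expr0 ?expr1 ?coefN coef1 eqxx.
  by rewrite [LHS]coef0_prod; apply: eq_bigr => i _; rewrite mxE.
have := coef0M (\det (1%:M - W)) (\det G).
by rewrite -det_mulmx propagator_eq det1 coef1 eqxx [X in _ = X * _]coef0_det coef0W
  det1 mul1r.
Qed.

End Propagator.

(** * The Gaussian and integration by parts *)

HB.lock Definition gauss (n : nat) : Qseries n :=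
  fps_exp (\sum_i g_ i * s_ i + \sum_i r_ i * f_ i
           + \sum_i \sum_j r_ i * W_ i j * s_ j).
Canonical gauss_unlockable := Unlockable gauss.unlock.

Section Gaussian.
Variable n : nat.
Implicit Types (i j l : 'I_n) (v : var n) (h : Qseries n).
Local Notation x_ := (@xvar n).
Local Notation G := (propagator n).
Local Notation E := (gauss n).

Definition gauss_exponent : Qseries n :=
  \sum_i x_ (Vg i) * x_ (Vs i) + \sum_i x_ (Vr i) * x_ (Vf i)
  + \sum_i \sum_j x_ (Vr i) * x_ (VW i j) * x_ (Vs j).

Lemma gaussE : E = fps_exp gauss_exponent.
Proof.
rewrite unlock; congr fps_exp; congr (_ + _ + _).
- by apply: eq_bigr => i _; rewrite !xvar.unlock.
- by apply: eq_bigr => i _; rewrite !xvar.unlock.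
by apply: eq_bigr => i _; apply: eq_bigr => j _; rewrite !xvar.unlock mxE.
Qed.

Lemma weight_in_gauss_exponent (V : nmodType) (w : var n -> V) (S : set V) :
    (forall i, S (w (Vg i) + w (Vs i))) ->
    (forall i, S (w (Vr i) + w (Vf i))) ->
    (forall i j, S (w (Vr i) + w (VW i j) + w (Vs j))) ->
  weight_in w S gauss_exponent.
Proof.
move=> Sgs Srf SrWs.
have weight_inV v : weight_in w (eq^~ (w v)) (x_ v) by apply: weight_in_xvar.
have weight_in_mul x y (f1 f2 : Qseries n) :
    weight_in w (eq^~ x) f1 -> weight_in w (eq^~ y) f2 ->
  weight_in w (eq^~ (x + y)) (f1 * f2) by apply: weight_inM => _ _ -> ->.
have weight_in_eq x (f : Qseries n) :
  weight_in w (eq^~ x) f -> S x -> weight_in w S f by move=> fx Sx m /fx->.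
apply: weight_inD; [apply: weight_inD|]; apply: weight_in_sum => i _.
- exact: weight_in_eq (weight_in_mul _ _ _ _ (weight_inV _) (weight_inV _)) _.
- exact: weight_in_eq (weight_in_mul _ _ _ _ (weight_inV _) (weight_inV _)) _.
apply: weight_in_sum => j _.
apply: weight_in_eq (weight_in_mul _ _ _ _ (weight_in_mul _ _ _ _
  (weight_inV _) (weight_inV _)) (weight_inV _)) _; exact: SrWs.
Qed.

Lemma coef0_gauss_exponent : coef gauss_exponent (mone _) = 0.
Proof. by apply/order_ge1/order_geE; apply: weight_in_gauss_exponent. Qed.

Lemma coef0_gauss : coef E (mone _) = 1.
Proof. by rewrite gaussE coef0_exp // coef0_gauss_exponent. Qed.

Lemma weight_in_gauss (V : nmodType) (w : var n -> V) (S : set V) :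
    S 0 -> (forall x y, S x -> S y -> S (x + y)) ->
    (forall i, S (w (Vg i) + w (Vs i))) ->
    (forall i, S (w (Vr i) + w (Vf i))) ->
    (forall i j, S (w (Vr i) + w (VW i j) + w (Vs j))) ->
  weight_in w S E.
Proof.
move=> *; rewrite gaussE; apply: weight_in_exp => //.
exact: weight_in_gauss_exponent.
Qed.

Lemma tame_gauss : tame E.
Proof. by exists 0; apply: weight_in_gauss => // x y; lia. Qed.

Lemma partial_gauss v : partial v E =
  match v with
  | Vr i => x_ (Vf i) + \sum_j x_ (VW i j) * x_ (Vs j)
  | Vs i => x_ (Vg i) + \sum_j x_ (Vr j) * x_ (VW j i)
  | Vg i => x_ (Vs i)
  | Vf i => x_ (Vr i)
  | VW i j => x_ (Vr i) * x_ (Vs j)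
  end * E.
Proof.
have dv := partial_derivation rat v.
rewrite gaussE partial_exp ?coef0_gauss_exponent //; congr (_ * _).
rewrite /gauss_exponent 2!(derD dv) 3!(der_sum dv).
have D2 (x y : 'I_n -> var n) : \sum_i partial v (x_ (x i) * x_ (y i)) =
    \sum_i (x i == v)%:R * x_ (y i) + \sum_i x_ (x i) * (y i == v)%:R.
  by rewrite -big_split; apply: eq_bigr => i _; rewrite (derM dv) !partial_xvar.
have D3 : \sum_i partial v (\sum_j x_ (Vr i) * x_ (VW i j) * x_ (Vs j)) =
    \sum_i (Vr i == v)%:R * (\sum_j x_ (VW i j) * x_ (Vs j)) +
    \sum_i \sum_j (VW i j == v)%:R * (x_ (Vr i) * x_ (Vs j)) +
    \sum_i \sum_j x_ (Vr i) * x_ (VW i j) * (Vs j == v)%:R.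
  rewrite -!big_split; apply: eq_bigr => i _ /=.
  rewrite (der_sum dv) mulr_sumr -!big_split; apply: eq_bigr => j _ /=.
  by rewrite !(derM dv) !partial_xvar; ring.
have D3s : \sum_i \sum_j x_ (Vr i) * x_ (VW i j) * (Vs j == v)%:R =
    \sum_j (\sum_i x_ (Vr i) * x_ (VW i j)) * (Vs j == v)%:R.
  by rewrite exchange_big; apply: eq_bigr => j _; rewrite mulr_suml.
rewrite !D2 D3 D3s.
have Z3 (F : 'I_n -> 'I_n -> Qseries n) : \sum_i \sum_j 0%:R * F i j = 0.
  by rewrite big1 // => i _; rewrite sum_0mul.
case: v {dv D2 D3 D3s} => [i|i|i|i|i j]; rewrite ?sum_0mul ?sum_mul0 ?Z3 ?addr0 ?add0r.
- by rewrite !sum_delta_mul.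
- by rewrite !sum_mul_delta.
- by rewrite !sum_delta_mul.
- by rewrite !sum_mul_delta.
under eq_bigr => k _ do under eq_bigr => l _ do
  rewrite -[_ == _]/((k == i) && (l == j)) -mulnb natrM -mulrA.
by under eq_bigr => k _ do rewrite -mulr_sumr sum_delta_mul; rewrite sum_delta_mul.
Qed.

(** The system reads [(1 - W) x = y]. *)
Lemma propagator_solve (x y : 'I_n -> Qseries n) :
    (forall i, x i = y i + \sum_j x_ (VW i j) * x j) ->
  forall i, x i = \sum_j G i j * y j.
Proof.
move=> xy i; pose cx := \col_i x i; pose cy := \col_i y i.
have : (1%:M - wmatrix n) *m cx = cy.
  apply/matrixP => k l; rewrite mulmxBl mul1mx !mxE.
  under eq_bigr => p _ do rewrite !mxE.
  by rewrite {1}xy addrK.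
move/(congr1 (mulmx G)); rewrite mulmxA (mulmx1C (propagator_eq n)) mul1mx.
by move/matrixP/(_ i ord0); rewrite !mxE => ->; apply: eq_bigr => j _; rewrite mxE.
Qed.

Lemma propagator_solve_tr (x y : 'I_n -> Qseries n) :
    (forall i, x i = y i + \sum_j x_ (VW j i) * x j) ->
  forall i, x i = \sum_j G j i * y j.
Proof.
move=> xy i; pose cx := \row_i x i; pose cy := \row_i y i.
have : cx *m (1%:M - wmatrix n) = cy.
  apply/matrixP => k l; rewrite mulmxBr mulmx1 !mxE.
  under eq_bigr => p _ do rewrite !mxE mulrC.
  by rewrite {1}xy addrK.
move/(congr1 (mulmx^~ G)); rewrite -mulmxA propagator_eq mulmx1.
move/matrixP/(_ ord0 i); rewrite !mxE => ->.
by apply: eq_bigr => j _; rewrite mxE mulrC.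
Qed.

Lemma tame_xvar v : tame (x_ v).
Proof. by rewrite unlock; apply: tame_var. Qed.

Lemma rs_free_xvar v : ~~ is_r_or_s v -> rs_free (x_ v).
Proof. by rewrite unlock; apply: rs_free_var. Qed.

Lemma contraction_s i h : tame h ->
  contraction (x_ (Vs i) * h) = contraction (partial (Vr i) h).
Proof. by rewrite unlock; apply: contraction_var (or_intror _). Qed.

Lemma contraction_r i h : tame h ->
  contraction (x_ (Vr i) * h) = contraction (partial (Vs i) h).
Proof. by rewrite unlock; apply: contraction_var (or_introl _). Qed.

(** Differentiating [h * E] in [r_i] gives [(dh/dr_i + f_i h) E] and the terms
[W_ij s_j h E], whose contractions are the unknowns again. *)
Lemma gauss_by_parts_s i h : tame h ->
  contraction (x_ (Vs i) * (h * E)) =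
  \sum_j G i j * contraction ((partial (Vr j) h + x_ (Vf j) * h) * E).
Proof.
move=> hT; have hET := tameM hT tame_gauss.
move: i; apply: propagator_solve => i.
rewrite contraction_s //; have dv := partial_derivation rat (Vr i).
have -> : partial (Vr i) (h * E) = (partial (Vr i) h + x_ (Vf i) * h) * E +
    \sum_j x_ (VW i j) * (x_ (Vs j) * (h * E)).
  rewrite (derM dv) partial_gauss.
  have -> : \sum_j x_ (VW i j) * (x_ (Vs j) * (h * E)) =
      (\sum_j x_ (VW i j) * x_ (Vs j)) * (h * E).
    by rewrite mulr_suml; apply: eq_bigr => j _; rewrite mulrA.
  by ring.
rewrite contractionD; first last.
- by apply: tame_sum => j _; do 2 ?apply: tameM => //; apply: tame_xvar.
- apply: tameM tame_gauss; apply: tameD; first exact: tame_partial.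
  by apply: tameM => //; apply: tame_xvar.
rewrite contraction_sum => [|j _].
  congr (_ + _); apply: eq_bigr => j _.
  rewrite contraction_freeM //; first exact: rs_free_xvar.
  by apply: tameM => //; apply: tame_xvar.
by do 2 ?apply: tameM => //; apply: tame_xvar.
Qed.

Lemma gauss_by_parts_r i h : tame h ->
  contraction (x_ (Vr i) * (h * E)) =
  \sum_j G j i * contraction ((partial (Vs j) h + x_ (Vg j) * h) * E).
Proof.
move=> hT; have hET := tameM hT tame_gauss.
move: i; apply: propagator_solve_tr => i.
rewrite contraction_r //; have dv := partial_derivation rat (Vs i).
have -> : partial (Vs i) (h * E) = (partial (Vs i) h + x_ (Vg i) * h) * E +
    \sum_j x_ (VW j i) * (x_ (Vr j) * (h * E)).
  rewrite (derM dv) partial_gauss.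
  have -> : \sum_j x_ (VW j i) * (x_ (Vr j) * (h * E)) =
      (\sum_j x_ (Vr j) * x_ (VW j i)) * (h * E).
    by rewrite mulr_suml; apply: eq_bigr => j _; ring.
  by ring.
rewrite contractionD; first last.
- by apply: tame_sum => j _; do 2 ?apply: tameM => //; apply: tame_xvar.
- apply: tameM tame_gauss; apply: tameD; first exact: tame_partial.
  by apply: tameM => //; apply: tame_xvar.
rewrite contraction_sum => [|j _].
  congr (_ + _); apply: eq_bigr => j _.
  rewrite contraction_freeM //; first exact: rs_free_xvar.
  by apply: tameM => //; apply: tame_xvar.
by do 2 ?apply: tameM => //; apply: tame_xvar.
Qed.

End Gaussian.

(** * Moments of the Gaussian *)

Section Moments.
Variable n : nat.
Implicit Types (i j l : 'I_n) (v : var n) (h : Qseries n) (k m : monom (var n)).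
Local Notation x_ := (@xvar n).
Local Notation G := (propagator n).
Local Notation E := (gauss n).

(** The substitution of the theorem, extended to all variables as [fps_comp]
requires. *)
Definition shift v : Qseries n :=
  match v with
  | Vr i => x_ (Vr i) + \sum_j x_ (Vg j) * G j i
  | Vs i => \sum_j G i j * (x_ (Vs j) + x_ (Vf j))
  | _ => x_ v
  end.

Definition shift_monom k := \prod_v shift v ^+ k v.

Lemma rs_free_shift_g i : rs_free (\sum_j x_ (Vg j) * G j i).
Proof.
apply: weight_in_sum => j _; apply: rs_freeM; first exact: rs_free_xvar.
exact: rs_free_propagator.
Qed.

Lemma tame_shift v : tame (shift v).
Proof.
case: v => [i|i|i|i|i j] /=; try exact: tame_xvar.
  by apply: tameD; [apply: tame_xvar | apply/tame_free/rs_free_shift_g].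
apply: tame_sum => j _; apply: tameM; first exact/tame_free/rs_free_propagator.
by apply: tameD; apply: tame_xvar.
Qed.

Lemma tame_shift_monom k : tame (shift_monom k).
Proof. by apply: tame_prod => v _; apply/tameX/tame_shift. Qed.

(** Hence the derivative in [r_j] of a substituted monomial is the substituted
derivative of the monomial. *)
Lemma partial_shift_r j v : partial (Vr j) (shift v) = (v == Vr j)%:R.
Proof.
have dr := partial_derivation rat (Vr j).
case: v => [i|i|i|i|i l] /=; try exact: partial_xvar.
  by rewrite (derD dr) partial_xvar (partial_free _ (@rs_free_shift_g i)) // addr0.
rewrite (der_sum dr) big1 // => l _; rewrite (derM dr) (derD dr) !partial_xvar.
rewrite (partial_free _ (@rs_free_propagator n _ _)) // mul0r add0r.
by rewrite add0r mulr0.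
Qed.

(** The analogue in [s_j] of the previous lemma fails, as the propagator mixes
the [s]; only monomials in [r] alone are differentiated in [s] below. *)
Lemma partial_shift_s j i : partial (Vs j) (shift (Vr i)) = 0.
Proof.
rewrite /= (derD (partial_derivation rat (Vs j))) partial_xvar.
by rewrite (partial_free _ (@rs_free_shift_g i)) // addr0.
Qed.

Lemma shift_monomS v k :
  shift_monom (madd k (mvar v)) = shift v * shift_monom k.
Proof.
rewrite /shift_monom (bigD1 v) //= [in RHS](bigD1 v) //= mulrA -exprS.
rewrite !monomE eqxx addn1; congr (_ * _).
by apply: eq_bigr => u /negPf neq_uv; rewrite !monomE neq_uv addn0.
Qed.

Lemma xvar_mono v k : x_ v * fps_mono k = fps_mono (madd k (mvar v)).
Proof. by rewrite xvarE -fps_monoD maddC. Qed.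

Lemma partial_mono v k :
  partial v (fps_mono k : Qseries n) = fps_mono (msub k (mvar v)) *+ k v.
Proof.
rewrite -!prod_fps_var; apply: der_monom; first exact: partial_derivation.
by move=> u; apply: partial_var.
Qed.

Lemma contractionMn h (p : nat) : contraction (h *+ p) = contraction h *+ p.
Proof. by rewrite -scaler_nat contractionZ scaler_nat. Qed.

Lemma contraction_rs_free h : rs_free h -> contraction h = h.
Proof.
move=> h_free; apply: fps_eqP => m.
have [m_free|nfree] := boolP (mfree m); last first.
  by rewrite !coef_nfree //; exact: contraction_free.
have m0 : madd m (rs_monom (mone _) (mone _)) = m.
  by apply/ffunP => -[i|i|i|i|i j]; rewrite !ffunE addn0.
rewrite (@coef_contraction _ _ _ [:: mone _]) //; last first.
  move=> k /(rs_freeP _).1-/(_ h_free); rewrite mfreeD => /andP[_ /mfreeP k0].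
  rewrite inE; apply/eqP/ffunP => i; have := k0 (Vr i) isT.
  by rewrite !ffunE.
rewrite big_seq1 m0 big1 ?mul1r // => i _.
by rewrite ffunE.
Qed.

Lemma tame_mono k : tame (fps_mono k : Qseries n).
Proof. by rewrite -prod_fps_var; apply: tame_prod => v _; apply/tameX/tame_var. Qed.

Definition rs_only k := forall v, ~~ is_r_or_s v -> k v = 0%N.

Lemma rs_only_sub k m : rs_only k -> rs_only (msub k m).
Proof. by move=> k0 v /k0; rewrite msubE => ->. Qed.

(** Both sides satisfy the recursion given by integration by parts.  The factors
[s] are removed first: then only derivatives in [r] of substituted monomials
occur, and once the monomial is free of [s] its derivatives in [s] vanish on
both sides. *)
Lemma gauss_moment k : rs_only k ->
  contraction (fps_mono k * E) = contraction E * contraction (shift_monom k).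
Proof.
have [d] := ubnP (mdeg k); elim: d k => [//|d IHd] k lt_kd k_rs.
have ET := tame_gauss n.
have monoT k' : tame (fps_mono k' * E) by apply: tameM => //; apply: tame_mono.
have MT := tame_shift_monom.
have smaller v : (0 < k v)%N -> (mdeg (msub k (mvar v)) < d)%N.
  move=> kv; have := @mdegB _ k (mvar v); rewrite mle_var mdeg_var => /(_ kv).
  by lia.
have sub_leq k' v : (mdeg (msub k' (mvar v)) <= mdeg k')%N.
  by apply: leq_sum => u _; rewrite msubE leq_subr.
have [/existsP[i ki]|/existsPn s0] := boolP [exists i, (0 < k (Vs i))%N].
  have := smaller _ ki; have := @rs_only_sub _ (mvar (Vs i)) k_rs.
  rewrite -{3 4}(@msubK _ k (mvar (Vs i))) ?mle_var //.
  move: (msub k _) => k' k'_rs lt_k'd {k lt_kd k_rs smaller ki}.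
  rewrite -xvar_mono shift_monomS -mulrA gauss_by_parts_s; last exact: tame_mono.
  rewrite mulr_suml contraction_sum => [|j _]; last first.
    apply: tameM => //; apply: tameM; first exact/tame_free/rs_free_propagator.
    by apply: tameD; apply: tame_xvar.
  rewrite mulr_sumr; apply: eq_bigr => j _.
  rewrite -!mulrA contraction_freeM; first last.
  - by apply: tameM => //; apply: tameD; apply: tame_xvar.
  - exact: rs_free_propagator.
  rewrite mulrCA; congr (_ * _); rewrite !mulrDl partial_mono.
  rewrite mulrnAl -!mulrA contractionD; first last.
  - by apply: tameM => //; apply: tame_xvar.
  - by rewrite -mulr_natl -scaler_nat fps_scaleAl; apply: tameZ; rewrite mul1r.
  rewrite contractionD; first last.
  - by apply: tameM => //; apply: tame_xvar.
  - by apply: tameM => //; apply: tame_xvar.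
  rewrite mulrDr contractionMn; congr (_ + _); last first.
    have f_free : rs_free (x_ (Vf j)) by apply: rs_free_xvar.
    rewrite !(contraction_freeM f_free) //.
    by rewrite IHd // mulrCA.
  rewrite contraction_s // /shift_monom.
  rewrite (der_monom (partial_derivation rat (Vr j)) k' (partial_shift_r j)).
  rewrite contractionMn mulrnAr IHd //; last exact: rs_only_sub.
  exact: leq_ltn_trans lt_k'd.
have {}s0 i : k (Vs i) = 0%N by have := s0 i; lia.
have [/existsP[i ki]|/existsPn r0] := boolP [exists i, (0 < k (Vr i))%N].
  have := smaller _ ki; have := @rs_only_sub _ (mvar (Vr i)) k_rs.
  have : forall j, msub k (mvar (Vr i)) (Vs j) = 0%N.
    by move=> j; rewrite msubE s0.
  rewrite -{4 5}(@msubK _ k (mvar (Vr i))) ?mle_var //.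
  move: (msub k _) => k' {}s0 k'_rs lt_k'd {k lt_kd k_rs smaller ki}.
  rewrite -xvar_mono shift_monomS -mulrA gauss_by_parts_r; last exact: tame_mono.
  have Us j : partial (Vs j) (shift_monom k') = 0.
    apply: (der_monom0 (partial_derivation rat (Vs j))) => -[l|l|l|l|l p].
    - by rewrite partial_shift_s.
    - by rewrite s0.
    - by rewrite k'_rs.
    - by rewrite k'_rs.
    - by rewrite k'_rs.
  rewrite /shift mulrDl contractionD; first last.
  - by apply: tameM => //; apply/tame_free/rs_free_shift_g.
  - by apply: tameM => //; apply: tame_xvar.
  rewrite contraction_r // Us contraction0 add0r.
  rewrite (contraction_freeM (@rs_free_shift_g i)) // mulrCA -IHd // mulr_suml.
  apply: eq_bigr => j _; rewrite partial_mono s0 mulr0n add0r -mulrA.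
  rewrite contraction_freeM //; last exact: rs_free_xvar.
  by rewrite mulrCA mulrA.
have -> : k = mone _.
  apply/ffunP => v; rewrite moneE; case: v => [i|i|i|i|i j]; last 3 first.
  - exact: k_rs.
  - exact: k_rs.
  - exact: k_rs.
  - by have := r0 i; rewrite -eqn0Ngt => /eqP.
  - exact: s0.
rewrite fps_mono0 mul1r [shift_monom _]big1 => [|v _]; last by rewrite moneE.
by rewrite [contraction 1]contraction_rs_free ?mulr1 //; apply: weight_in1.
Qed.

Definition source_form : Qseries n :=
  \sum_i \sum_j x_ (Vg i) * G i j * x_ (Vf j).

Lemma contraction_sE i : contraction (x_ (Vs i) * E) =
  (\sum_j G i j * x_ (Vf j)) * contraction E.
Proof.
rewrite -[E in LHS]mul1r gauss_by_parts_s; last exact: tame1.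
rewrite mulr_suml; apply: eq_bigr => j _; rewrite -mulrA; congr (_ * _).
rewrite (der1 (partial_derivation rat _)) add0r mulr1 contraction_freeM //.
  exact: rs_free_xvar.
exact: tame_gauss.
Qed.

Lemma contraction_rE i : contraction (x_ (Vr i) * E) =
  (\sum_j x_ (Vg j) * G j i) * contraction E.
Proof.
rewrite -[E in LHS]mul1r gauss_by_parts_r; last exact: tame1.
rewrite mulr_suml; apply: eq_bigr => j _.
rewrite (der1 (partial_derivation rat _)) add0r mulr1 contraction_freeM //.
- by rewrite mulrA (mulrC (G j i)).
- exact: rs_free_xvar.
exact: tame_gauss.
Qed.

(** Integrate by parts in [s_j] with [h = r_i]: the derivative of [r_i] yields the
propagator, and [f_l r_i] yields the product of the two one-variable moments. *)
Lemma contraction_rsE i j : contraction (x_ (Vr i) * x_ (Vs j) * E) =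
  (G j i + (\sum_l x_ (Vg l) * G l i) * (\sum_l G j l * x_ (Vf l)))
    * contraction E.
Proof.
have ET := tame_gauss n.
rewrite -mulrA mulrCA gauss_by_parts_s; last exact: tame_xvar.
pose S := \sum_l x_ (Vg l) * G l i.
transitivity (\sum_l G j l * (((l == i)%:R + x_ (Vf l) * S) * contraction E)).
  apply: eq_bigr => l _; congr (_ * _).
  have Cb (b : bool) : contraction (b%:R * E) = b%:R * contraction E.
    by case: b; rewrite ?mul1r ?mul0r ?contraction0.
  rewrite mulrDl contractionD; first last.
  - by rewrite -mulrA; do 2?apply: tameM => //; apply: tame_xvar.
  - by apply: tameM => //; apply/tame_partial/tame_xvar.
  rewrite partial_xvar Cb -mulrA contraction_freeM; first last.
  - by apply: tameM => //; apply: tame_xvar.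
  - exact: rs_free_xvar.
  by rewrite contraction_rE mulrDl mulrA var_eqE eq_sym.
rewrite -/S -(sum_mul_delta (G j) i) mulr_sumr -big_split mulr_suml.
by apply: eq_bigr => l _ /=; ring.
Qed.

(** Growth at most 0 means that a monomial of [E] in [r] and [s] alone is 1. *)
Lemma coef0_contraction_gauss : coef (contraction E) (mone _) = 1.
Proof.
rewrite (@coef_contraction _ _ _ [:: mone _]) //.
- rewrite big_seq1 big1 => [|i _]; last by rewrite moneE.
  rewrite mul1r madd0m -[RHS](coef0_gauss n); congr (coef E _).
  by apply/ffunP => -[i|i|i|i|i j]; rewrite !ffunE.
- by apply/mfreeP => v _; rewrite moneE.
move=> k; rewrite madd0m inE => Ek; apply/eqP/ffunP => i.
have : weight (@growth n) (rs_monom k k) <= 0.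
  move: Ek; apply: (weight_in_gauss (S := fun x => x <= 0)) => // x y; lia.
by move/(le_trans (growth_rs_monom k i)); rewrite moneE lez_nat leqn0 => /eqP.
Qed.

Lemma coef0_source_form : coef source_form (mone _) = 0.
Proof.
apply/order_ge1; apply: order_ge_sum => i _; apply: order_ge_sum => j _.
by apply: order_geMl; rewrite order_geE; apply: weight_in_xvar.
Qed.

(** The common logarithmic derivative of the two sides of [contraction_gauss]. *)
Definition log_derivative v : Qseries n :=
  match v with
  | Vr _ | Vs _ => 0
  | Vg i => \sum_j G i j * x_ (Vf j)
  | Vf i => \sum_j x_ (Vg j) * G j i
  | VW i j => G j i + (\sum_l x_ (Vg l) * G l i) * (\sum_l G j l * x_ (Vf l))
  end.

Lemma partial_contraction_gauss v :
  partial v (contraction E) = log_derivative v * contraction E.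
Proof.
have rs_case : is_r_or_s v -> partial v (contraction E) = 0 * contraction E.
  by move=> rs_v; rewrite mul0r (partial_free rs_v) //; exact: contraction_free.
case: v rs_case => [i|i|i|i|i j] rs_case; try exact: rs_case.
- by rewrite partial_contraction ?partial_gauss ?contraction_sE //; exact: tame_gauss.
- by rewrite partial_contraction ?partial_gauss ?contraction_rE //; exact: tame_gauss.
by rewrite partial_contraction ?partial_gauss ?contraction_rsE //; exact: tame_gauss.
Qed.

Lemma partial_source_form v : partial v source_form =
  \sum_i (Vg i == v)%:R * (\sum_j G i j * x_ (Vf j)) +
  \sum_j (\sum_i x_ (Vg i) * G i j) * (Vf j == v)%:R +
  \sum_i \sum_j x_ (Vg i) * partial v (G i j) * x_ (Vf j).
Proof.
have dv := partial_derivation rat v.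
have -> : \sum_j (\sum_i x_ (Vg i) * G i j) * (Vf j == v)%:R =
    \sum_i \sum_j x_ (Vg i) * G i j * (Vf j == v)%:R.
  by rewrite exchange_big; apply: eq_bigr => j _; rewrite mulr_suml.
rewrite /source_form (der_sum dv) -!big_split; apply: eq_bigr => i _ /=.
rewrite (der_sum dv) mulr_sumr -!big_split; apply: eq_bigr => j _ /=.
by rewrite !(derM dv) !partial_xvar; ring.
Qed.

Lemma partial_normalisation v :
  partial v (\det G * fps_exp source_form) =
  log_derivative v * (\det G * fps_exp source_form).
Proof.
have dv := partial_derivation rat v.
rewrite (derM dv) (partial_exp coef0_source_form).
suff -> : partial v (\det G) =
    (log_derivative v - partial v source_form) * \det G by ring.
rewrite partial_source_form.
have Z3 : (forall p q, v != VW p q) ->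
    \sum_i \sum_j x_ (Vg i) * partial v (G i j) * x_ (Vf j) = 0.
  move=> vW; rewrite big1 // => i _; rewrite big1 // => j _.
  by rewrite partial_propagator // mulr0 mul0r.
case: v {dv} Z3 => [i|i|i|i|i j] Z3; last first.
  rewrite partial_det_propagator_W sum_0mul sum_mul0 !add0r; congr (_ * _).
  rewrite -[LHS]addr0 -addrA; congr (_ + _); apply/esym/eqP; rewrite subr_eq0.
  apply/eqP; rewrite mulr_suml; apply: eq_bigr => k _; rewrite mulr_sumr.
  by apply: eq_bigr => l _; rewrite partial_propagator_W; ring.
all: rewrite partial_det_propagator // Z3 // ?sum_0mul ?sum_mul0 ?addr0 ?add0r.
- by rewrite sum_mul_delta subrr mul0r.
- by rewrite sum_delta_mul subrr mul0r.
- by rewrite mul0r.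
- by rewrite mul0r.
Qed.

(** The logarithmic derivatives and the constant terms agree. *)
Lemma contraction_gauss : contraction E = \det G * fps_exp source_form.
Proof.
apply: partial_system_unique partial_contraction_gauss partial_normalisation _.
rewrite coef0_contraction_gauss coef0M coef0_exp ?coef0_source_form //.
by rewrite coef0_det_propagator mulr1.
Qed.

End Moments.

(** * The grading and the reduction to monomials *)

Section Grading.
Variable n : nat.
Implicit Types (i j l : 'I_n) (v : var n) (h : Qseries n) (m t : monom (var n)).
Implicit Types (k : monom 'I_n).
Local Notation x_ := (@xvar n).
Local Notation G := (propagator n).
Local Notation E := (gauss n).

Section Weights.
Variables (V : zmodType) (rho sigma : 'I_n -> V).

(** The most general weight for which the exponent [gs + rf + rWs] has weight
0. *)
Definition source_weight v : V :=
  match v with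
  | Vr i => rho i
  | Vs i => sigma i
  | Vg i => - sigma i
  | Vf i => - rho i
  | VW i j => - rho i - sigma j
  end.

Lemma homogeneous_gauss : weight_in source_weight (fun x => x = 0) E.
Proof.
apply: weight_in_gauss => [//|x y -> ->|i|i|i j] /=; rewrite ?addr0 //.
- exact: addNr.
- exact: subrr.
by rewrite addrA subrr sub0r addNr.
Qed.

Lemma weight_rs_monom k1 k2 :
  weight source_weight (rs_monom k1 k2) = weight rho k1 + weight sigma k2.
Proof.
have rs0 : rs_monom (mone _) (mone _) = mone _ :> monom (var n).
  by apply/ffunP => -[i|i|i|i|i j]; rewrite !ffunE.
have rsr i : rs_monom (mvar i) (mone _) = mvar (Vr i).
  by apply/ffunP => -[j|j|j|j|j l]; rewrite !ffunE // var_eqE.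
have rss i : rs_monom (mone _) (mvar i) = mvar (Vs i).
  by apply/ffunP => -[j|j|j|j|j l]; rewrite !ffunE // var_eqE.
elim/monom_ind: k1 => [|k1 i IHk].
  rewrite weight0 add0r; elim/monom_ind: k2 => [|k2 i IHk].
    by rewrite rs0 !weight0.
  rewrite -{1}[mone _]madd0m rs_monomD rss.
  by rewrite !weightD IHk !weight_var.
rewrite -{1}[k2]maddm0 rs_monomD rsr.
by rewrite !weightD IHk !weight_var addrAC.
Qed.

End Weights.

Lemma rs_onlyP t : rs_only t -> exists k1 k2, t = rs_monom k1 k2.
Proof.
move=> t0; exists [ffun i => t (Vr i)], [ffun i => t (Vs i)].
by apply/ffunP => -[i|i|i|i|i j]; rewrite !ffunE // t0.
Qed.

Lemma rs_onlyD t1 t2 : rs_only t1 -> rs_only t2 -> rs_only (madd t1 t2).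
Proof. by move=> t10 t20 v rs_v; rewrite maddE t10 // t20. Qed.

Definition unit_row i : 'rV[int]_n := delta_mx 0 i.

Lemma weight_unit_row_inj : injective (weight unit_row).
Proof.
move=> k1 k2 /matrixP eq_k; apply/ffunP => i; have := eq_k 0 i.
have weightE k : weight unit_row k 0 i = (k i)%:Z.
  rewrite summxE (bigD1 i) //= big1 => [|j /negPf neq_ji]; last first.
    by rewrite mulmxnE mxE eqxx eq_sym neq_ji /= mul0rn.
  by rewrite mulmxnE mxE !eqxx addr0; apply: natz.
by rewrite !weightE => -[].
Qed.

(** The weight with values in Z^n that contraction preserves, because [r_i * s_i]
has weight 0. *)
Definition balance := source_weight unit_row (fun i => - unit_row i).

Lemma balanced_gauss : weight_in balance (eq^~ 0) E.
Proof. exact: homogeneous_gauss. Qed.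

Lemma weightN (V : zmodType) (w : 'I_n -> V) k :
  weight (fun i => - w i) k = - weight w k.
Proof. by rewrite /weight -sumrN; apply: eq_bigr => i _; rewrite mulNrn. Qed.

Lemma balance_rs_monom k : weight balance (rs_monom k k) = 0.
Proof. by rewrite weight_rs_monom weightN subrr. Qed.

Lemma balanced_rs_only t : rs_only t -> weight balance t = 0 ->
  exists k, t = rs_monom k k.
Proof.
move=> /rs_onlyP[k1 [k2 ->]]; rewrite weight_rs_monom weightN => /eqP.
by rewrite subr_eq0 => /eqP/weight_unit_row_inj->; exists k2.
Qed.

(** Two further weights, one counting [r] and one counting [s], both vanish on the
monomials of [E]; they recover the exponents of [r] and [s] from [m]. *)
Lemma gauss_support_unique m t1 t2 : rs_only t1 -> rs_only t2 ->
  coef E (madd m t1) != 0 -> coef E (madd m t2) != 0 -> t1 = t2.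
Proof.
move=> /rs_onlyP[k1 [l1 ->]] /rs_onlyP[k2 [l2 ->]] E1 E2.
have eq_weight (rho sigma : 'I_n -> 'rV[int]_n) :
    weight rho k1 + weight sigma l1 = weight rho k2 + weight sigma l2.
  have := homogeneous_gauss rho sigma E1.
  rewrite -(homogeneous_gauss rho sigma E2) !weightD.
  by move/addrI; rewrite !weight_rs_monom.
have w0 k : weight (fun=> 0 : 'rV[int]_n) k = 0.
  by rewrite /weight big1 // => i _; rewrite mul0rn.
have := eq_weight unit_row (fun=> 0); rewrite !w0 !addr0.
have := eq_weight (fun=> 0) unit_row; rewrite !w0 !add0r.
by move=> /weight_unit_row_inj-> /weight_unit_row_inj->.
Qed.

(** Each derivative of [E] in a variable [g_i], [f_i], [W_ij] is [E] times a
monomial in [r] and [s]: build up [m] one variable at a time. *)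
Lemma gauss_support m : mfree m ->
  exists2 t, rs_only t & coef E (madd m t) != 0.
Proof.
elim/monom_ind: m => [|m v IHm].
  exists (mone _); first by move=> v _; rewrite moneE.
  by rewrite maddm0 coef0_gauss.
rewrite mfreeD mfree_var => /andP[/IHm[t t_rs Et] nrs_v].
have [c c_rs Dv] : exists2 c, rs_only c & partial v E = fps_mono c * E.
  have var_rs u : is_r_or_s u -> rs_only (mvar u).
    by move=> rs_u u'; rewrite mvarE; case: eqP => [->|//]; rewrite rs_u.
  rewrite partial_gauss; case: (v) nrs_v => [i|i|i|i|i j] // _.
  - by exists (mvar (Vs i)); [exact: var_rs | rewrite xvarE].
  - by exists (mvar (Vr i)); [exact: var_rs | rewrite xvarE].
  exists (madd (mvar (Vr i)) (mvar (Vs j))); last by rewrite fps_monoD !xvarE.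
  by apply: rs_onlyD; apply: var_rs.
exists (madd t c); first exact: rs_onlyD.
have := coef_partial v E (madd (madd m t) c); rewrite Dv coef_monoMD.
have -> : madd (madd (madd m t) c) (mvar v) = madd (madd m (mvar v)) (madd t c).
  by apply/ffunP => u; rewrite !monomE; lia.
by move=> EtE; apply: contra_neq Et; rewrite EtE => ->; rewrite mul0rn.
Qed.

Lemma depends_rs_only (P : Qseries n) t : depends_only_on (@is_r_or_s n) P ->
  coef P t != 0 -> rs_only t.
Proof. by move=> P_rs /P_rs. Qed.

(** A monomial [j] of the component contributes to the term [k] of the contraction
with [j * t = r ^ k * s ^ k], where [t] completes [m] to a monomial of [E].  It
is the only one to do so, so this term is nonzero, and [k] determines [j]. *)
Lemma finite_component (P : Qseries n) m :
    depends_only_on (@is_r_or_s n) P -> contractible (P * E) -> mfree m ->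
  finite_set [set t | coef P t != 0 /\ weight balance t = weight balance m].
Proof.
move=> P_rs /(_ m) PE_fin m_free; have [t t_rs Et] := gauss_support m_free.
apply: sub_finite_set (finite_image (fun k => msub (rs_monom k k) t) PE_fin).
move=> j [Pj bal_j]; have j_rs := depends_rs_only P_rs Pj.
have jt_rs := rs_onlyD j_rs t_rs.
have [k jtE] : exists k, madd j t = rs_monom k k.
  apply: balanced_rs_only jt_rs _; rewrite weightD bal_j -weightD.
  exact: homogeneous_gauss.
exists k; last by rewrite -jtE maddK.
rewrite /mkset coef_contraction_terms m_free -jtE mulf_neq0 //.
  by rewrite pnatr_eq0 -lt0n prodn_gt0 // => i; exact: fact_gt0.
have -> : coef (P * E) (madd m (madd j t)) = coef P j * coef E (madd m t).
  have mE : msub (madd m (madd j t)) j = madd m t.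
    by rewrite maddA maddAC maddK.
  rewrite coefM (bigD1_seq j) ?mdivisors_uniq //=; last first.
    by rewrite mem_mdivisors maddA maddAC mle_addl.
  rewrite mE big_seq_cond big1 ?addr0 // => j' /andP[+ neq_j'].
  rewrite mem_mdivisors => /mleP le_j'.
  have [->|Pj'] := eqVneq (coef P j') 0; first by rewrite mul0r.
  have j'_rs := depends_rs_only P_rs Pj'.
  have le_j't v : (j' v <= j v + t v)%N.
    have [rs_v|nrs_v] := boolP (is_r_or_s v); last by rewrite j'_rs.
    by have := le_j' v; rewrite !maddE (mfreeP _ m_free).
  have [->|Ej'] := eqVneq (coef E (msub (madd m (madd j t)) j')) 0.
    by rewrite mulr0.
  (* The monomial [j'] of [P] completes [m] by the monomial [j + t - j']. *)
  suff eq_j : msub (madd j t) j' = t.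
    case/eqP: neq_j'; apply: (@maddIr _ _ _ t); rewrite -{1}eq_j maddC msubK //.
    by apply/mleP => v; rewrite maddE.
  apply: gauss_support_unique Et; rewrite ?Ej' //; first exact: rs_only_sub.
  suff -> : madd m (msub (madd j t) j') = msub (madd m (madd j t)) j' by [].
  by apply/ffunP => v; rewrite !monomE addnBA.
by rewrite mulf_neq0.
Qed.

Lemma homogeneous_propagator i j :
  weight_in balance (eq^~ (unit_row j - unit_row i)) (G i j).
Proof.
apply: (weight_in_propagator (S := fun i j => eq^~ (unit_row j - unit_row i))).
  by move=> k; rewrite subrr.
by move=> p q r x ->; rewrite /= opprK addrC addrA addrAC subrK.
Qed.

(** Each propagator entry [G_ij] has the weight of [r_j * s_i], the same as that of
every path from [i] to [j]. *)
Lemma homogeneous_shift v : weight_in balance (eq^~ (balance v)) (shift v).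
Proof.
have add_eq a b (f1 f2 : Qseries n) : weight_in balance (eq^~ a) f1 ->
    weight_in balance (eq^~ b) f2 -> weight_in balance (eq^~ (a + b)) (f1 * f2).
  by apply: weight_inM => _ _ -> ->.
have xeq u : weight_in balance (eq^~ (balance u)) (x_ u) by apply: weight_in_xvar.
case: v => [i|i|i|i|i j] /=; try exact: xeq.
  apply: weight_inD; first exact: xeq.
  apply: weight_in_sum => j _.
  have := add_eq _ _ _ _ (xeq (Vg j)) (@homogeneous_propagator j i).
  by rewrite /= opprK addrC subrK.
apply: weight_in_sum => j _.
have -> : - unit_row i = (unit_row j - unit_row i) - unit_row j.
  by rewrite addrC addKr.
apply: (add_eq (unit_row j - unit_row i)); first exact: homogeneous_propagator.
by apply: weight_inD; [exact: (xeq (Vs j)) | exact: (xeq (Vf j))].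
Qed.

Lemma homogeneous_shift_monom t :
  weight_in balance (eq^~ (weight balance t)) (shift_monom t).
Proof.
elim/monom_ind: t => [|t v IHt].
  rewrite weight0 [shift_monom _]big1 => [|v _]; first exact: weight_in1.
  by rewrite moneE.
rewrite shift_monomS weightD weight_var addrC.
by apply: (weight_inM _ (@homogeneous_shift v) IHt) => _ _ -> ->.
Qed.

Lemma homogeneous_contraction_gauss :
  weight_in balance (eq^~ 0) (contraction E).
Proof.
move=> m /coef_fps_sum_neq0[k]; rewrite coefZ /= -/(mfree m); case: ifP => [_|_].
  move=> Ek; have : coef E (madd m (rs_monom k k)) != 0.
    by apply: contra_neq Ek => ->; rewrite mulr0.
  by move/balanced_gauss; rewrite weightD balance_rs_monom addr0.
by rewrite mulr0 eqxx.
Qed.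

(** Compare the coefficients of a monomial [m].  Only the monomials of [P] with the
weight of [m] matter, and there are finitely many of them: replace [P] by the
polynomial [Q] that they form, then use [gauss_moment] on each monomial. *)
Lemma gaussian_contraction (P : Qseries n) :
    depends_only_on (@is_r_or_s n) P -> contractible (P * E) ->
  contraction (P * E) = contraction E * contraction (fps_comp P (@shift n)).
Proof.
move=> P_rs PE_fin; apply: fps_eqP => m.
have [m_free|nfree] := boolP (mfree m); last first.
  by rewrite !coef_nfree //; [apply: rs_freeM|]; exact: contraction_free.
have /finite_seqP[s0 s0P] := finite_component P_rs PE_fin m_free.
pose s := undup s0; have s_uniq : uniq s by exact: undup_uniq.
have mem_s t : coef P t != 0 -> weight balance t = weight balance m -> t \in s.
  move=> Pt bal_t; rewrite mem_undup.
  by have : [set` s0]%classic t by rewrite -s0P.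
have s_rs t : t \in s -> rs_only t.
  rewrite mem_undup => s0t; have : [set` s0]%classic t by [].
  by rewrite -s0P => -[/(depends_rs_only P_rs)].
pose Q := \sum_(t <- s) coef P t *: fps_mono t.
pose Q' := \sum_(t <- s) coef P t *: shift_monom t.
have coefQ t : weight balance t = weight balance m -> coef Q t = coef P t.
  move=> bal_t; rewrite coef_sum; have [ts|nts] := boolP (t \in s).
    rewrite (bigD1_seq t) // coefZ coef_mono eqxx mulr1.
    rewrite big1 => [|t' neq_t]; first exact: addr0.
    by rewrite coefZ coef_mono eq_sym (negPf neq_t) mulr0.
  have -> : coef P t = 0 by apply: contraNeq nts => /mem_s; apply.
  rewrite big_seq big1 // => t' t's; rewrite coefZ coef_mono.
  by case: eqP t's => [<-|_ _]; rewrite ?(negPf nts) ?mulr0.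
have coefQE M : weight balance M = weight balance m ->
    coef (P * E) M = coef (Q * E) M.
  move=> bal_M; rewrite !coefM big_seq [RHS]big_seq; apply: eq_bigr => t.
  rewrite mem_mdivisors => le_t.
  have [->|Et] := eqVneq (coef E (msub M t)) 0; first by rewrite !mulr0.
  rewrite coefQ // -bal_M -[in RHS](msubK le_t) weightD.
  by rewrite (balanced_gauss Et) add0r.
have coefQ' M : weight balance M = weight balance m ->
    coef (fps_comp P (@shift n)) M = coef Q' M.
  move=> bal_M; rewrite (coef_fps_sum s_uniq) ?coef_sum // => t; rewrite coefZ => PtM.
  apply: mem_s; first by apply: contra_neq PtM => ->; rewrite mul0r.
  rewrite -bal_M; apply/esym/homogeneous_shift_monom.
  by apply: contra_neq PtM => ->; rewrite mulr0.
have ET := tame_gauss n.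
have bal_rs m' k : weight balance (madd m' (rs_monom k k)) = weight balance m'.
  by rewrite weightD balance_rs_monom addr0.
transitivity (coef (contraction (Q * E)) m).
  by apply: eq_contraction => k _; apply: coefQE.
transitivity (coef (contraction E * contraction Q') m); last first.
  rewrite !coefM big_seq [RHS]big_seq; apply: eq_bigr => t.
  rewrite mem_mdivisors => le_t.
  have [->|Et] := eqVneq (coef (contraction E) t) 0; first by rewrite !mul0r.
  congr (_ * _); apply/esym/eq_contraction => k _; apply: coefQ'.
  rewrite bal_rs -[in RHS](msubK le_t) weightD.
  by rewrite (homogeneous_contraction_gauss Et) addr0.
congr (coef _ m); rewrite /Q mulr_suml contraction_sum => [|t _]; last first.
  by rewrite fps_scaleAl; apply/tameZ/tameM => //; apply: tame_mono.
rewrite contraction_sum => [|t _]; last by apply/tameZ/tame_shift_monom.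
rewrite mulr_sumr big_seq [RHS]big_seq; apply: eq_bigr => t /s_rs t_rs.
rewrite fps_scaleAl !contractionZ gauss_moment //.
by rewrite [RHS]mulrC fps_scaleAl mulrC.
Qed.

End Grading.

Theorem theorem6 (n : nat) (P : Qseries n) :
  in_Rn P ->
  depends_only_on (@is_r_or_s n) P ->
  let E := fps_exp (\sum_i g_ i * s_ i + \sum_i r_ i * f_ i
                    + \sum_i \sum_j r_ i * W_ i j * s_ j) in
  let P' := subst_rs P (fun i => r_ i + \sum_k g_ k * Wt k i)
                       (fun i => \sum_j Wt i j * (s_ j + f_ j)) in
  contractible (P * E) ->
  contractible P' ->
  contraction (P * E) =
    \det Wt * fps_exp (\sum_i \sum_j g_ i * Wt i j * f_ j) * contraction P'.
Proof.
move=> _ P_rs E P' + _; have -> : E = gauss n by rewrite gauss.unlock.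
move=> PE_fin; rewrite gaussian_contraction // contraction_gauss.
have propE i j : propagator n i j = Wt i j by rewrite propagator.unlock.
congr (_ * fps_exp _ * contraction _); first by rewrite propagator.unlock.
  apply: eq_bigr => i _; apply: eq_bigr => j _.
  by rewrite propE !xvar.unlock.
congr fps_comp; apply/funext => -[i|i|i|i|i j] /=; rewrite ?xvar.unlock //.
  by congr (_ + _); apply: eq_bigr => j _; rewrite propE.
by apply: eq_bigr => j _; rewrite propE.
Qed.
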